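(* Let $\Lambda$ be a semigroup as in the context. Then $$P_{\mathrm{geom}}^{(Z^\Lambda,0)}(T)=\sum_{\theta\le\sigma}P(\Lambda\cap\theta^\perp).$$
   Context: $M$ is a lattice of rank $d$, $N$ its dual lattice. $\Lambda\subset M$ is a finitely generated sub-semigroup (containing $0$) which generates $M$ as a group and such that $\sigma^\vee:=\mathbb{R}_{\ge0}\Lambda\subset M_{\mathbb{R}}$ is a strictly convex cone of dimension $d$; $\sigma\subset N_{\mathbb{R}}$ is the dual cone. $Z^\Lambda:=\mathrm{Spec}\,\mathbb{C}[\Lambda]$, embedded in affine space by the minimal generators of $\Lambda$; $0$ is the origin, defined by the maximal ideal $(X^\lambda)_{0\ne\lambda\in\Lambda}$. $\theta\le\sigma$ means $\theta$ is a face of $\sigma$. For $\theta\le\sigma$, $\Lambda\cap\theta^\perp$ is a finitely generated semigroup generating a lattice $M(\theta,\Lambda)$, and the dual cone of $\mathbb{R}_{\ge0}(\Lambda\cap\theta^\perp)$ is the image $\sigma/\mathbb{R}\theta$ of $\sigma$ in $N_{\mathbb{R}}/\mathbb{R}\theta$; $Z^{\Lambda\cap\theta^\perp}$ is an orbit closure in $Z^\Lambda$ containing the origin. $H_\Lambda$ is the set of arcs $\mathrm{Spec}\,\mathbb{C}[[t]]\to Z^\Lambda$ with origin $0$; $H_\Lambda^*$ is the subset of arcs $h$ with $X^u\circ h\ne0$ for all $u\in\Lambda$; $H_{\Lambda\cap\theta^\perp}\subset H_\Lambda$ consists of the arcs factoring through $Z^{\Lambda\cap\theta^\perp}$; $j_s$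 is truncation mod $t^{s+1}$ to $s$-jets. In $K_0(\mathrm{Var}_{\mathbb{C}})[[T]]$, where $K_0(\mathrm{Var}_{\mathbb{C}})$ is the Grothendieck ring of complex varieties, $$P_{\mathrm{geom}}^{(Z^\Lambda,0)}(T)=\sum_{s\ge0}[j_s(H_\Lambda)]T^s,\qquad P(\Lambda)=\sum_{s\ge0}\Big[j_s(H_\Lambda^* )\setminus\bigcup_{0\ne\theta\le\sigma}j_s(H_{\Lambda\cap\theta^\perp})\Big]T^s.$$ $P(\Lambda\cap\theta^\perp)$ is defined by the same formula applied to the semigroup $\Lambda\cap\theta^\perp$, the lattice $M(\theta,\Lambda)$ and the cone $\sigma/\mathbb{R}\theta$; for $\theta=\sigma$, $\Lambda\cap\sigma^\perp=\{0\}$ and $P(\Lambda\cap\sigma^\perp)=\sum_{s\ge0}[\{0\}]T^s=(1-T)^{-1}$. *)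

(* Defs.v *)
From HB Require Import structures.
From mathcomp Require Import all_boot all_order all_algebra finmap.
From mathcomp Require Import generic_quotient.
From mathcomp Require Import boolp classical_sets functions fsbigop reals.
From mathcomp Require Import complex.
From mathcomp.multinomials Require Import mpoly.
From mathcomp.multinomials Require monalg.

Set Implicit Arguments.
Unset Strict Implicit.
Unset Printing Implicit Defensive.

Import Order.TTheory GRing.Theory Num.Theory.
Local Open Scope classical_set_scope.
Local Open Scope ring_scope.

(* [f n] is the coefficient of the n-th power of the variable *)
Definition fps (A : Type) : Type := nat -> A.

Section FpsRing.
Variable A : pzRingType.
Implicit Types f g h : fps A.

HB.instance Definition _ := GRing.Zmodule.copy (fps A) (nat -> A).

Definition fps_one : fps A := fun n => (n == 0%N)%:R.
Definition fps_mul f g : fps A := fun n => \sum_(i < n.+1) f i * g (n - i)%N.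

Lemma fpsDE f g n : (f + g) n = f n + g n. Proof. by []. Qed.

Lemma fps_mul_rev f g n : fps_mul f g n = \sum_(i < n.+1) f (n - i)%N * g i.
Proof.
rewrite /fps_mul (reindex_inj rev_ord_inj) /=.
by apply: eq_bigr => i _; rewrite subSS subKn // -ltnS.
Qed.

Lemma fps_mulA : associative fps_mul.
Proof.
move=> p q r; apply/funext => i; rewrite /(fps_mul p) [RHS]fps_mul_rev.
pose coef3 j k := p j * (q (i - j - k)%N * r k).
transitivity (\sum_(j < i.+1) \sum_(k < i.+1 | (k <= i - j)%N) coef3 j k).
  apply: eq_bigr => /= j _; rewrite fps_mul_rev big_distrr /=.
  by rewrite (big_ord_narrow_leq (leq_subr _ _)).
rewrite (exchange_big_dep predT) //=; apply: eq_bigr => k _.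
transitivity (\sum_(j < i.+1 | (j <= i - k)%N) coef3 j k).
  apply: eq_bigl => j; rewrite -ltnS -(ltnS j) -!subSn ?leq_ord //.
  by rewrite -subn_gt0 -(subn_gt0 j) -!subnDA addnC.
rewrite (big_ord_narrow_leq (leq_subr _ _)) /fps_mul big_distrl /=.
by apply: eq_bigr => j _; rewrite /coef3 -!subnDA addnC mulrA.
Qed.

Lemma fps_mul1 : left_id fps_one fps_mul.
Proof.
move=> f; apply/funext => n; rewrite /fps_mul big_ord_recl /fps_one /= mul1r.
by rewrite subn0 big1 ?addr0 // => i _; rewrite mul0r.
Qed.

Lemma fps_mulr1 : right_id fps_one fps_mul.
Proof.
move=> f; apply/funext => n; rewrite fps_mul_rev big_ord_recl /fps_one /= mulr1.
by rewrite subn0 big1 ?addr0 // => i _; rewrite mulr0.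
Qed.

Lemma fps_mulDl : left_distributive fps_mul +%R.
Proof.
move=> f g h; apply/funext => n; rewrite fpsDE /fps_mul -big_split /=.
by apply: eq_bigr => i _; rewrite fpsDE mulrDl.
Qed.

Lemma fps_mulDr : right_distributive fps_mul +%R.
Proof.
move=> f g h; apply/funext => n; rewrite fpsDE /fps_mul -big_split /=.
by apply: eq_bigr => i _; rewrite fpsDE mulrDr.
Qed.

HB.instance Definition _ := GRing.Zmodule_isPzRing.Build (fps A)
  fps_mulA fps_mul1 fps_mulr1 fps_mulDl fps_mulDr.

Definition fps_scale (c : A) f : fps A := fun n => c * f n.

Lemma fps_scaleA a b f : fps_scale a (fps_scale b f) = fps_scale (a * b) f.
Proof. by apply/funext => n; rewrite /fps_scale mulrA. Qed.
Lemma fps_scale1 : left_id 1 fps_scale.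
Proof. by move=> f; apply/funext => n; rewrite /fps_scale mul1r. Qed.
Lemma fps_scaleDr : right_distributive fps_scale +%R.
Proof. by move=> c f g; apply/funext => n; rewrite /fps_scale !fpsDE mulrDr. Qed.
Lemma fps_scaleDl f : {morph fps_scale^~ f : a b / a + b}.
Proof. by move=> a b; apply/funext => n; rewrite /fps_scale fpsDE mulrDl. Qed.

HB.instance Definition _ := GRing.Zmodule_isLmodule.Build A (fps A)
  fps_scaleA fps_scale1 fps_scaleDr fps_scaleDl.

End FpsRing.

Lemma fps_mulC (A : comPzRingType) : commutative (@fps_mul A).
Proof.
move=> f g; apply/funext => n; rewrite fps_mul_rev.
by apply: eq_bigr => i _; rewrite mulrC.
Qed.

HB.instance Definition _ (A : comPzRingType) :=
  GRing.PzRing_hasCommutativeMul.Build (fps A) (@fps_mulC A).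

Lemma fps_oner_neq0 (A : nzRingType) : (1 : fps A) != 0.
Proof. by apply/eqP => /(congr1 (fun f : fps A => f 0%N)) /eqP; rewrite oner_eq0. Qed.

HB.instance Definition _ (A : nzRingType) :=
  GRing.PzSemiRing_isNonZero.Build (fps A) (@fps_oner_neq0 A).

Lemma fps_scaleAl (A : nzRingType) (c : A) (f g : fps A) : c *: (f * g) = (c *: f) * g.
Proof.
apply/funext => n; rewrite [LHS]big_distrr /=.
by apply: eq_bigr => i _; rewrite mulrA.
Qed.

HB.instance Definition _ (A : nzRingType) := GRing.LSemiModule_isLSemiAlgebra.Build A (fps A) (@fps_scaleAl A).

(* The monoid algebra K[N] of a commutative monoid N, written additively, with
   basis the monomials [mono u] = X^u. The product that the library puts on
   [malg N K] needs N without invertible elements, hence this copy. *)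
Definition monoid_alg (K : nzRingType) (N : choiceType) := monalg.malg N K.

Section MonoidAlgebra.
Variables (K : comNzRingType) (N : nmodType).
Notation KN := (monoid_alg K N).
Import monalg.
Implicit Types (a b : KN).

HB.instance Definition _ := GRing.Lmodule.copy KN (malg N K).

Definition mono (u : N) : KN := mkmalgU u 1.

Definition malg_mul a b : KN :=
  \sum_(u <- msupp a) \sum_(v <- msupp b) mkmalgU (u + v) (mcoeff u a * mcoeff v b).

Lemma malg_mulw (d1 d2 : {fset N}) a b :
  fsubset (msupp a) d1 -> fsubset (msupp b) d2 ->
  malg_mul a b =
    \sum_(u <- d1) \sum_(v <- d2) mkmalgU (u + v) (mcoeff u a * mcoeff v b).
Proof.
move=> le_d1 le_d2; rewrite /malg_mul (big_fset_incl _ le_d1) /=.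
  apply/eq_bigr=> k1 _; apply/big_fset_incl => // k _ /mcoeff_outdom ->.
  by rewrite mulr0 monalgU0.
move=> k _ /mcoeff_outdom g1k.
by rewrite big1 => // k' _; rewrite g1k mul0r monalgU0.
Qed.

Lemma malg_mulC : commutative malg_mul.
Proof.
move=> a b; rewrite /malg_mul exchange_big; apply: eq_bigr => u _.
by apply: eq_bigr => v _; rewrite addrC mulrC.
Qed.

Lemma malg_mulDl : left_distributive malg_mul +%R.
Proof.
move=> a b c.
rewrite (malg_mulw (msuppD_le a b) (fsubset_refl (msupp c))).
rewrite (malg_mulw (fsubsetUl (msupp a) (msupp b)) (fsubset_refl (msupp c))).
rewrite (malg_mulw (fsubsetUr (msupp a) (msupp b)) (fsubset_refl (msupp c))).
rewrite -big_split /=; apply: eq_bigr => u _.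
rewrite -big_split /=; apply: eq_bigr => v _.
by rewrite mcoeffD mulrDl monalgUD.
Qed.

Lemma malg_mulDr : right_distributive malg_mul +%R.
Proof. by move=> a b c; rewrite !(malg_mulC a) malg_mulDl. Qed.

Lemma malg_mul0l : left_zero 0 malg_mul.
Proof. by move=> a; rewrite /malg_mul msupp0 big_seq_fset0. Qed.

Lemma malg_mul0r : right_zero 0 malg_mul.
Proof. by move=> a; rewrite malg_mulC malg_mul0l. Qed.

Lemma malg_mulUU c1 c2 (u1 u2 : N) :
  malg_mul (mkmalgU u1 c1) (mkmalgU u2 c2) = mkmalgU (u1 + u2) (c1 * c2).
Proof. by rewrite (malg_mulw msuppU_le msuppU_le) !big_seq_fset1 !mcoeffUU. Qed.

Lemma malg_ext (F G : KN -> KN) :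
  {morph F : x y / x + y} -> {morph G : x y / x + y} ->
  (forall c u, F (mkmalgU u c) = G (mkmalgU u c)) -> F =1 G.
Proof.
move=> addF addG FG.
have F0 (H : KN -> KN) : {morph H : x y / x + y} -> H 0 = 0.
  by move=> addH; apply: (addrI (H 0)); rewrite -addH !addr0.
move=> a; rewrite (monalgE a) (big_morph F addF (F0 F addF)).
by rewrite (big_morph G addG (F0 G addG)); apply: eq_bigr => u _; apply: FG.
Qed.

Lemma malg_mulA : associative malg_mul.
Proof.
move=> a b c; move: a.
apply: malg_ext => [x y|x y|k u]; rewrite ?malg_mulDl //; move: b.
apply: malg_ext => [x y|x y|l v]; rewrite ?(malg_mulDl, malg_mulDr) //; move: c.
apply: malg_ext => [x y|x y|m w]; rewrite ?malg_mulDr //.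
by rewrite !malg_mulUU mulrA addrA.
Qed.

Lemma malg_mul1 : left_id (mono 0) malg_mul.
Proof.
apply: malg_ext => [x y|//|k u]; first exact: malg_mulDr.
by rewrite malg_mulUU mul1r add0r.
Qed.

Lemma malg_one_neq0 : mono 0 != 0.
Proof.
apply/eqP => /(congr1 (mcoeff (0 : N))) /eqP.
by rewrite mcoeffUU mcoeff0 oner_eq0.
Qed.

HB.instance Definition _ := GRing.Zmodule_isComNzRing.Build KN
  malg_mulA malg_mulC malg_mul1 malg_mulDl malg_one_neq0.

Lemma malg_scaleAl (c : K) a b : c *: (a * b) = (c *: a) * b.
Proof.
have scE d (x : KN) : d *: x = malg_mul (mkmalgU 0 d) x.
  move: x; apply: malg_ext => [x y|x y|k u]; rewrite ?scalerDr ?malg_mulDr //.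
  by rewrite malg_mulUU add0r; apply/malgP => v; rewrite mcoeffZ !mcoeffU mulrnAr.
by rewrite !scE; apply: malg_mulA.
Qed.

HB.instance Definition _ := GRing.LSemiModule_isLSemiAlgebra.Build K KN malg_scaleAl.

End MonoidAlgebra.

Arguments mono {K N} u.

Section Zariski.
Variable K : closedFieldType.

Definition zclosed n (A : set 'rV[K]_n) : Prop :=
  exists S : set {mpoly K[n]}, A = [set x | forall p, S p -> p.@[x ord0] = 0].

Definition zclosed_in n (V A : set 'rV[K]_n) : Prop :=
  exists F, zclosed F /\ A = V `&` F.

Definition zopen_in n (V A : set 'rV[K]_n) : Prop :=
  exists F, zclosed F /\ A = V `\` F.

Definition locally_closed n (A : set 'rV[K]_n) : Prop :=
  exists V, zclosed V /\ zopen_in V A.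

Definition regular_on n (A : set 'rV[K]_n) (f : 'rV[K]_n -> K) : Prop :=
  forall x, A x -> exists p q : {mpoly K[n]}, q.@[x ord0] != 0 /\
    forall y, A y -> q.@[y ord0] != 0 -> f y = p.@[y ord0] / q.@[y ord0].

Definition regular_map n m (A : set 'rV[K]_n) (f : 'rV[K]_n -> 'rV[K]_m) : Prop :=
  forall j, regular_on A (fun x => f x ord0 j).

Lemma zclosedT n : zclosed (setT : set 'rV[K]_n).
Proof. by exists set0; apply/seteqP; split => // x _ p []. Qed.

Lemma zclosed0 n : zclosed (set0 : set 'rV[K]_n).
Proof.
exists [set 1]; apply/seteqP; split => x //= /(_ 1 erefl).
by rewrite meval1 => /eqP; rewrite oner_eq0.
Qed.

Lemma zclosedI n (A B : set 'rV[K]_n) : zclosed A -> zclosed B -> zclosed (A `&` B).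
Proof.
move=> [S ->] [T ->]; exists (S `|` T); apply/seteqP; split => x /=.
  by move=> [hS hT] p [/hS|/hT].
by move=> h; split => p hp; apply: h; [left|right].
Qed.

Lemma zclosedU n (A B : set 'rV[K]_n) : zclosed A -> zclosed B -> zclosed (A `|` B).
Proof.
move=> [S ->] [T ->].
exists [set r | exists p q, [/\ S p, T q & r = p * q]].
apply/seteqP; split => x /=.
  by case=> h r [p [q [hp hq ->]]]; rewrite mevalM;
    [rewrite (h p hp) mul0r | rewrite (h q hq) mulr0].
move=> h; have [hS|/existsNP[p /not_implyP[hp /eqP px]]] :=
  pselect (forall p, S p -> p.@[x ord0] = 0); first by left.
right => q hq; have /eqP := h (p * q) (ex_intro _ p (ex_intro _ q (And3 hp hq erefl))).
by rewrite mevalM mulf_eq0 (negPf px) => /eqP.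
Qed.

Lemma locally_closedT n : locally_closed (setT : set 'rV[K]_n).
Proof.
exists setT; split; first exact: zclosedT.
by exists set0; split; [exact: zclosed0 | rewrite setD0].
Qed.

Lemma locally_closedI_closed n (V A : set 'rV[K]_n) :
  locally_closed V -> zclosed_in V A -> locally_closed A.
Proof.
move=> [W [cW [F [cF ->]]]] [G [cG ->]]; exists (W `&` G); split.
  exact: zclosedI.
by exists F; split=> //; apply/seteqP; split => x /=; rewrite /setI /setD /=; tauto.
Qed.

Lemma locally_closedD_closed n (V A : set 'rV[K]_n) :
  locally_closed V -> zclosed_in V A -> locally_closed (V `\` A).
Proof.
move=> [W [cW [F [cF ->]]]] [G [cG ->]]; exists W; split => //.
exists (F `|` G); split; first exact: zclosedU.
by apply/seteqP; split => x; rewrite /setI /setD /setU /=; tauto.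
Qed.

(* An algebraic variety in the sense of Weil and Serre: a set of points with a
   finite atlas, here of quasi-affine charts, with regular transition maps
   between open subsets; [v_sep] says that the diagonal is closed. Varieties
   need not be irreducible. The points are encoded in [seq K], which loses
   nothing (a variety has at most as many points as [seq K] has elements) and
   makes the varieties a type of the same universe level as [K]. *)
Record variety := Variety {
  vnum : nat;
  vdim : 'I_vnum -> nat;
  vdom : 'I_vnum -> set (seq K);
  vchart : forall i, seq K -> 'rV[K]_(vdim i);
  v_inj : forall i x y, vdom i x -> vdom i y -> vchart i x = vchart i y -> x = y;
  v_lc : forall i, locally_closed (vchart i @` vdom i);
  v_open : forall i j,
    zopen_in (vchart i @` vdom i) (vchart i @` (vdom i `&` vdom j));
  v_trans : forall i j, exists g,
    regular_map (vchart i @` (vdom i `&` vdom j)) g /\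
    forall x, vdom i x -> vdom j x -> vchart j x = g (vchart i x);
  v_sep : forall i j,
    zclosed_in [set row_mx y z | y in vchart i @` vdom i & z in vchart j @` vdom j]
               [set row_mx (vchart i x) (vchart j x) | x in vdom i `&` vdom j]
}.

Definition vpt (X : variety) : set (seq K) := [set x | exists i : 'I_(vnum X), vdom i x].

(* morphisms are only considered on [vpt X], their values elsewhere are junk *)
Definition is_morphism (X Y : variety) (f : seq K -> seq K) : Prop :=
  (forall x, vpt X x -> vpt Y (f x)) /\
  forall (i : 'I_(vnum X)) (j : 'I_(vnum Y)),
    let D := vchart i @` (vdom i `&` f @^-1` vdom j) in
    zopen_in (vchart i @` vdom i) D /\
    exists g, regular_map D g /\
      forall x, vdom i x -> vdom j (f x) -> vchart j (f x) = g (vchart i x).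

Definition isomorphic (X Y : variety) : Prop :=
  exists f g, [/\ is_morphism X Y f, is_morphism Y X g,
    (forall x, vpt X x -> g (f x) = x) & (forall y, vpt Y y -> f (g y) = y)].

(* X x Y is only characterized by its universal property *)
Definition is_product (X Y Z : variety) (p q : seq K -> seq K) : Prop :=
  [/\ is_morphism Z X p, is_morphism Z Y q &
    forall (T : variety) f g, is_morphism T X f -> is_morphism T Y g ->
      let lift h := is_morphism T Z h /\
        forall t, vpt T t -> p (h t) = f t /\ q (h t) = g t in
      (exists h, lift h) /\
      forall h h', lift h -> lift h' -> forall t, vpt T t -> h t = h' t].

Section QuasiAffine.
Variable n : nat.

Definition seq_of_rV (x : 'rV[K]_n) : seq K := [seq x ord0 i | i <- enum 'I_n].
Definition rV_of_seq (s : seq K) : 'rV[K]_n := \row_i s`_i.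

Lemma seq_of_rVK : cancel seq_of_rV rV_of_seq.
Proof.
move=> x; apply/rowP => i; rewrite mxE (nth_map i) ?size_enum_ord ?ltn_ord //.
by rewrite nth_ord_enum.
Qed.

Variable A : set 'rV[K]_n.

Lemma rV_of_seq_image : rV_of_seq @` (seq_of_rV @` A) = A.
Proof.
apply/seteqP; split => [_ [_ [x Ax <-] <-]|x Ax]; first by rewrite seq_of_rVK.
by exists (seq_of_rV x); [exists x | rewrite seq_of_rVK].
Qed.

Lemma regular_id (B : set 'rV[K]_n) : regular_map B id.
Proof.
move=> j x _; exists 'X_j, 1; rewrite meval1 oner_neq0; split => // y _ _.
by rewrite mevalXU meval1 divr1.
Qed.

Lemma zclosed_diag : zclosed [set row_mx x x | x in @setT 'rV[K]_n].
Proof.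
exists [set 'X_(lshift n i) - 'X_(rshift n i) | i in @setT 'I_n].
apply/seteqP; split => [_ [x _ <-] _ [i _ <-]|x h] /=.
  by rewrite mevalB !mevalXU row_mxEl row_mxEr subrr.
exists (lsubmx x) => //; rewrite -[RHS]hsubmxK; congr row_mx.
apply/rowP => i; rewrite !mxE; apply/eqP; rewrite -subr_eq0; apply/eqP.
have := h _ (ex_intro2 _ _ i I erefl).
by rewrite mevalB !mevalXU.
Qed.

Definition qaff (lcA : locally_closed A) : variety.
Proof.
refine (@Variety 1 (fun=> n) (fun=> seq_of_rV @` A) (fun=> rV_of_seq) _ _ _ _ _).
- by move=> _ _ _ [x _ <-] [y _ <-]; rewrite !seq_of_rVK => ->.
- by move=> _; rewrite rV_of_seq_image.
- move=> _ _; rewrite setIid; exists set0; split; first exact: zclosed0.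
  by rewrite setD0.
- by move=> _ _; exists id; split => //; apply: regular_id.
- move=> _ _; exists [set row_mx x x | x in @setT 'rV[K]_n]; split.
    exact: zclosed_diag.
  rewrite setIid rV_of_seq_image; apply/seteqP; split => /=.
    move=> _ [_ [x Ax <-] <-]; rewrite seq_of_rVK.
    by split; exists x => //; exists x.
  move=> _ [[y Ay [z Az <-]] [x _ /eq_row_mx[xy xz]]].
  by exists (seq_of_rV y); [exists y | rewrite seq_of_rVK -xy -xz].
Defined.

End QuasiAffine.

Section Subvariety.
Variable X : variety.
Implicit Types A : set (seq K).

Definition vclosed A : Prop := forall i : 'I_(vnum X),
  zclosed_in (vchart i @` vdom i) (vchart i @` (vdom i `&` A)).

Definition vlocally_closed A : Prop := forall i : 'I_(vnum X),
  locally_closed (vchart i @` (vdom i `&` A)).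

Lemma vclosed_lc A : vclosed A -> vlocally_closed A.
Proof. by move=> cA i; apply: locally_closedI_closed (cA i); apply: v_lc. Qed.

Lemma vclosedC_lc A : vclosed A -> vlocally_closed (~` A).
Proof.
move=> cA i; suff -> : vchart i @` (vdom i `&` ~` A) =
    vchart i @` vdom i `\` vchart i @` (vdom i `&` A).
  by apply: locally_closedD_closed (cA i); apply: v_lc.
apply/seteqP; split => [_ [x [dx nA] <-]|_ [[x dx <-] nAx]].
  by split; [exists x | move=> [y [dy Ay] /v_inj yx]; apply: nA; rewrite -yx].
by exists x => //; split => // Ax; apply: nAx; exists x.
Qed.

Lemma regular_onS n (B C : set 'rV[K]_n) f :
  B `<=` C -> regular_on C f -> regular_on B f.
Proof.
move=> BC rf x /BC /rf[p [q [qx h]]]; exists p, q; split => // y /BC; exact: h.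
Qed.

(* the locally closed subset of the points of [X] that lie in [A], with its
   reduced structure *)
Definition subvariety A (lcA : vlocally_closed A) : variety.
Proof.
refine (@Variety (vnum X) (@vdim X) (fun i => vdom i `&` A) (@vchart X) _ _ _ _ _).
- by move=> i x y [dx _] [dy _]; apply: v_inj.
- exact: lcA.
- move=> i j; have [F [cF hF]] := @v_open X i j; exists F; split => //.
  apply/seteqP; split => [_ [x [[dx Ax] [dx' _]] <-]|_ [[x [dx Ax] <-] nF]].
    split; first by exists x.
    have : (vchart i @` (vdom i `&` vdom j)) (vchart i x) by exists x.
    by rewrite hF => -[].
  have : (vchart i @` vdom i `\` F) (vchart i x) by split=> //; exists x.
  by rewrite -hF => -[y [dy dyj] /v_inj yx]; exists x => //; rewrite -yx in Ax *.
- move=> i j; have [g [rg hg]] := @v_trans X i j; exists g; split; last first.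
    by move=> x [dx _] [dx' _]; apply: hg.
  move=> k; apply: regular_onS (rg k) => _ [x [[dx _] [dx' _]] <-].
  by exists x.
- move=> i j; have [F [cF hF]] := @v_sep X i j; exists F; split => //.
  have hS x y : vdom i x -> vdom j y -> F (row_mx (vchart i x) (vchart j y)) <->
      [set row_mx (vchart i x) (vchart j x) | x in vdom i `&` vdom j]
        (row_mx (vchart i x) (vchart j y)).
    rewrite hF => dx dy; split => [Fxy|[]//]; split => //.
    by exists (vchart i x); [exists x | exists (vchart j y) => //; exists y].
  apply/seteqP; split => [_ [x [[di Ax] [dj _]] <-]|].
    split; last by apply/hS => //; exists x.
    by exists (vchart i x); [exists x | exists (vchart j x) => //; exists x].
  move=> _ [[_ [x [di Ax] <-] [_ [y [dj _] <-] <-]] /hS-/(_ di dj)].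
  move=> [z [zi zj] /eq_row_mx[zx zy]]; rewrite -zy.
  have {}zx := v_inj zi di zx; rewrite zx in zj *.
  by exists x.
Defined.

End Subvariety.
End Zariski.

(* The commutative ring generated by the symbols [X], for X a variety,
   with the relations [X] = [Y] if X and Y are isomorphic,
   [X] = [A] + [X \ A] for A closed in X, [X x Y] = [X][Y] and [point] = 1. *)
Section GrothendieckRing.
Variable K : closedFieldType.

Inductive K0_expr :=
| K0var of variety K
| K0zero
| K0opp of K0_expr
| K0add of K0_expr & K0_expr
| K0one
| K0mul of K0_expr & K0_expr.

Inductive K0_rel : K0_expr -> K0_expr -> Prop :=
| K0_refl x : K0_rel x x
| K0_sym x y : K0_rel x y -> K0_rel y x
| K0_trans x y z : K0_rel x y -> K0_rel y z -> K0_rel x z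
| K0_oppC x y : K0_rel x y -> K0_rel (K0opp x) (K0opp y)
| K0_addC x y z t : K0_rel x y -> K0_rel z t -> K0_rel (K0add x z) (K0add y t)
| K0_mulC x y z t : K0_rel x y -> K0_rel z t -> K0_rel (K0mul x z) (K0mul y t)
| K0_addrA x y z : K0_rel (K0add x (K0add y z)) (K0add (K0add x y) z)
| K0_addrC x y : K0_rel (K0add x y) (K0add y x)
| K0_add0r x : K0_rel (K0add K0zero x) x
| K0_addNr x : K0_rel (K0add (K0opp x) x) K0zero
| K0_mulrA x y z : K0_rel (K0mul x (K0mul y z)) (K0mul (K0mul x y) z)
| K0_mulrC x y : K0_rel (K0mul x y) (K0mul y x)
| K0_mul1r x : K0_rel (K0mul K0one x) x
| K0_mulrDl x y z : K0_rel (K0mul (K0add x y) z) (K0add (K0mul x z) (K0mul y z))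
| K0_iso X Y : isomorphic X Y -> K0_rel (K0var X) (K0var Y)
| K0_scissor X A (cA : vclosed X A) :
    K0_rel (K0var X) (K0add (K0var (subvariety (vclosed_lc cA)))
                            (K0var (subvariety (vclosedC_lc cA))))
| K0_prod X Y Z p q :
    is_product X Y Z p q -> K0_rel (K0var Z) (K0mul (K0var X) (K0var Y))
| K0_point : K0_rel (K0var (qaff (@locally_closedT K 0))) K0one.

HB.instance Definition _ := gen_eqMixin K0_expr.
HB.instance Definition _ := gen_choiceMixin K0_expr.

Definition K0_relb : rel K0_expr := fun x y => `[< K0_rel x y >].

Lemma K0_relb_equiv : equiv_class_of K0_relb.
Proof.
split=> [x|x y|y x z]; first by apply/asboolP; apply: K0_refl.
  by apply/asboolP/asboolP; apply: K0_sym.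
by move=> /asboolP xy /asboolP yz; apply/asboolP; apply: K0_trans xy yz.
Qed.

Local Open Scope quotient_scope.

Canonical K0_equiv := EquivRelPack K0_relb_equiv.

Canonical K0_encModRel := defaultEncModRel K0_relb.

Definition K0 : Type := {eq_quot K0_relb}.
HB.instance Definition _ := Choice.on K0.
HB.instance Definition _ := EqQuotient.on K0.

Lemma K0_eqP (x y : K0_expr) : K0_rel x y -> \pi_K0 x = \pi_K0 y.
Proof. by move=> h; apply/eqmodP/asboolP. Qed.

Lemma K0_repr (x : K0_expr) : K0_rel (repr (\pi_K0 x)) x.
Proof. by have /eqmodP/asboolP := reprK (\pi_K0 x). Qed.

Let K0_0 : K0 := \pi_K0 K0zero.
Let K0_1 : K0 := \pi_K0 K0one.
Let K0_opp (x : K0) : K0 := \pi_K0 (K0opp (repr x)).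
Let K0_add (x y : K0) : K0 := \pi_K0 (K0add (repr x) (repr y)).
Let K0_mul (x y : K0) : K0 := \pi_K0 (K0mul (repr x) (repr y)).

Let piN x : K0_opp (\pi_K0 x) = \pi_K0 (K0opp x).
Proof. by apply: K0_eqP; apply: K0_oppC; apply: K0_repr. Qed.
Let piD x y : K0_add (\pi_K0 x) (\pi_K0 y) = \pi_K0 (K0add x y).
Proof. by apply: K0_eqP; apply: K0_addC; apply: K0_repr. Qed.
Let piM x y : K0_mul (\pi_K0 x) (\pi_K0 y) = \pi_K0 (K0mul x y).
Proof. by apply: K0_eqP; apply: K0_mulC; apply: K0_repr. Qed.

Let piP (P : K0 -> Prop) : (forall x, P (\pi_K0 x)) -> forall x, P x.
Proof. by move=> h x; rewrite -[x]reprK; apply: h. Qed.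

Let addA : associative K0_add.
Proof.
elim/piP => x; elim/piP => y; elim/piP => z.
by rewrite !piD; apply: K0_eqP; apply: K0_addrA.
Qed.
Let addC : commutative K0_add.
Proof.
by elim/piP => x; elim/piP => y; rewrite !piD; apply: K0_eqP; apply: K0_addrC.
Qed.
Let add0 : left_id K0_0 K0_add.
Proof. by elim/piP => x; rewrite piD; apply: K0_eqP; apply: K0_add0r. Qed.
Let addN : left_inverse K0_0 K0_opp K0_add.
Proof. by elim/piP => x; rewrite piN piD; apply: K0_eqP; apply: K0_addNr. Qed.
Let mulA : associative K0_mul.
Proof.
elim/piP => x; elim/piP => y; elim/piP => z.
by rewrite !piM; apply: K0_eqP; apply: K0_mulrA.
Qed.
Let mulC : commutative K0_mul.
Proof.
by elim/piP => x; elim/piP => y; rewrite !piM; apply: K0_eqP; apply: K0_mulrC.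
Qed.
Let mul1 : left_id K0_1 K0_mul.
Proof. by elim/piP => x; rewrite piM; apply: K0_eqP; apply: K0_mul1r. Qed.
Let mulDl : left_distributive K0_mul K0_add.
Proof.
elim/piP => x; elim/piP => y; elim/piP => z.
by rewrite !(piD, piM); apply: K0_eqP; apply: K0_mulrDl.
Qed.

HB.instance Definition _ := GRing.isZmodule.Build K0 addA addC add0 addN.
HB.instance Definition _ := GRing.Zmodule_isComPzRing.Build K0 mulA mulC mul1 mulDl.

Definition K0_of (X : variety K) : K0 := \pi_K0 (K0var X).

Lemma K0_of_iso X Y : isomorphic X Y -> K0_of X = K0_of Y.
Proof. by move=> XY; apply: K0_eqP; apply: K0_iso. Qed.

Lemma K0_of_scissor X A (cA : vclosed X A) :
  K0_of X = K0_of (subvariety (vclosed_lc cA)) + K0_of (subvariety (vclosedC_lc cA)).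
Proof. by rewrite [RHS]piD; apply: K0_eqP; apply: K0_scissor. Qed.

Lemma K0_of_prod X Y Z p q :
  is_product X Y Z p q -> K0_of Z = K0_of X * K0_of Y.
Proof. by move=> pq; rewrite [RHS]piM; apply: K0_eqP; apply: K0_prod pq. Qed.

Record lcset n := LcSet {
  lcset_set :> set 'rV[K]_n;
  lcsetP : locally_closed lcset_set
}.

Definition lc_partition n (A : set 'rV[K]_n) k (L : 'I_k -> lcset n) : Prop :=
  A = \bigcup_(i in setT) L i /\ trivIset setT (fun i => L i : set 'rV[K]_n).

Definition constructible n (A : set 'rV[K]_n) : Prop :=
  exists L : {k & 'I_k -> lcset n}, lc_partition A (projT2 L).

(* [A] is the sum of the classes of the pieces of any partition of A into
   finitely many locally closed sets; it is only meaningful, and arbitrarily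
   set to 0 otherwise, when A is constructible. *)
Definition K0_class n (A : set 'rV[K]_n) : K0 :=
  if pselect (constructible A) is left cA then
    let L := sval (cid cA) in \sum_i K0_of (qaff (lcsetP (projT2 L i)))
  else 0.

End GrothendieckRing.

Definition is_lattice (M : zmodType) (d : nat) : Prop :=
  exists b : 'I_d -> M,
    forall x, exists! c : {ffun 'I_d -> int}, x = \sum_i b i *~ c i.

Section Semigroup.
Variable M : zmodType.

Record sg_elt (L : addrClosed M) := SgElt { sg_val : M; sg_valP : sg_val \in L }.

HB.instance Definition _ (L : addrClosed M) := [isSub for @sg_val L].
HB.instance Definition _ (L : addrClosed M) := [Choice of sg_elt L by <:].

Lemma sg_elt_closed (L : addrClosed M) : Algebra.nmod_closed (fun x => x \in L).
Proof. by split; [exact: (rpred0 L) | move=> x y; exact: (@rpredD M L x y)]. Qed.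

HB.instance Definition _ (L : addrClosed M) :=
  GRing.SubChoice_isSubNmodule.Build M _ (sg_elt L) (sg_elt_closed L).

Definition generates (L : addrClosed M) (G : seq (sg_elt L)) : Prop :=
  forall u, exists c : nat -> nat, u = \sum_(i < size G) G`_i *+ c i.

Definition fin_generated (L : addrClosed M) : Prop := exists G, @generates L G.

Definition is_min_gens (L : addrClosed M) (G : seq (sg_elt L)) : Prop :=
  [/\ uniq G, generates G &
    forall G', {subset G' <= G} -> generates G' -> {subset G <= G'}].

(* the minimal generators of L, in some order, if L is finitely generated *)
Definition min_gens (L : addrClosed M) : seq (sg_elt L) :=
  xget [::] [set G | is_min_gens G].

Definition is_subgroup (H : set M) : Prop :=
  H 0 /\ forall x y, H x -> H y -> H (x - y).

Definition span_pred (L : addrClosed M) : {pred M} :=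
  fun x => `[< smallest is_subgroup [set y | y \in L] x >].

Lemma span_zmod_closed (L : addrClosed M) : GRing.zmod_closed (span_pred L).
Proof.
split; first by apply/asboolP => H [[]].
move=> x y /asboolP hx /asboolP hy; apply/asboolP => H HL.
by apply: HL.1.2; [apply: hx | apply: hy].
Qed.

HB.instance Definition _ (L : addrClosed M) :=
  GRing.isZmodClosed.Build M (span_pred L) (span_zmod_closed L).

Record lat_elt (L : addrClosed M) :=
  LatElt { lat_val : M; lat_valP : lat_val \in span_pred L }.

HB.instance Definition _ (L : addrClosed M) := [isSub for @lat_val L].
HB.instance Definition _ (L : addrClosed M) := [Choice of lat_elt L by <:].
HB.instance Definition _ (L : addrClosed M) :=
  GRing.SubChoice_isSubZmodule.Build M _ (lat_elt L) (span_zmod_closed L).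

Definition lat_sg (L : addrClosed M) : {pred lat_elt L} := fun x => lat_val x \in L.
Arguments lat_sg : clear implicits.

Lemma lat_sg_closed (L : addrClosed M) : Algebra.nmod_closed (lat_sg L).
Proof.
split; first exact: (rpred0 L).
by move=> x y; apply: rpredD.
Qed.

HB.instance Definition _ (L : addrClosed M) :=
  GRing.isAddClosed.Build (lat_elt L) (lat_sg L) (@lat_sg_closed L).

End Semigroup.

Arguments lat_sg {M} L x.

Section Cones.
Variables (R : realType) (M : zmodType).

(* For M a lattice with dual lattice N, [NR] is N_R = Hom (M, R), and M_R is
   identified with a space of functions on N_R through the duality pairing. *)
Definition NR : Type := {additive M -> R}.
Definition MR : Type := NR -> R^o.
HB.instance Definition _ := GRing.Lmodule.copy MR (NR -> R^o).

Definition inMR (u : M) : MR := fun nu => nu u.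

Definition cone_of (L : addrClosed M) : set MR :=
  [set w | exists k (c : 'I_k -> R) (u : 'I_k -> M),
    (forall i, 0 <= c i /\ u i \in L) /\ w = \sum_i c i *: inMR (u i)].

Definition strictly_convex (C : set MR) : Prop := forall w, C w -> C (- w) -> w = 0.

Definition cone_dim (C : set MR) (d : nat) : Prop :=
  exists v : 'I_d -> MR, [/\ forall i, C (v i),
    forall c : 'I_d -> R, \sum_i c i *: v i = 0 -> forall i, c i = 0 &
    forall w, C w -> exists c : 'I_d -> R, w = \sum_i c i *: v i].

Definition dual_cone (C : set MR) : set NR := [set nu | forall w, C w -> 0 <= w nu].

(* theta is a face of the dual cone sigma of C *)
Definition is_face (C : set MR) (theta : set NR) : Prop :=
  exists2 w, C w & theta = [set nu | dual_cone C nu /\ w nu = 0].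

Definition perp (L : addrClosed M) (theta : set NR) : {pred M} :=
  fun u => (u \in L) && `[< forall nu, theta nu -> nu u = 0 >].

Lemma perp_closed (L : addrClosed M) theta : Algebra.nmod_closed (perp L theta).
Proof.
split; first by apply/andP; split; [exact: rpred0 | apply/asboolP => nu _; rewrite raddf0].
move=> u v /andP[uL /asboolP hu] /andP[vL /asboolP hv]; apply/andP; split.
  exact: rpredD.
by apply/asboolP => nu h; rewrite raddfD hu // hv // addr0.
Qed.

HB.instance Definition _ (L : addrClosed M) theta :=
  GRing.isAddClosed.Build M (perp L theta) (@perp_closed L theta).

End Cones.

Arguments cone_of R {M} L.

Section Arcs.
Variables (R : realType) (M : zmodType).
Notation C := R[i].
Implicit Types (L : addrClosed M) (s : nat).

Notation sg_alg L := (monoid_alg C (sg_elt L)).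

(* A morphism Spec C[[t]] -> Spec C[L] is a C-algebra morphism C[L] -> C[[t]]. *)
Definition arc L : Type := {lrmorphism sg_alg L -> fps C}.

(* h maps the closed point to the point with ideal (X^u), u != 0 *)
Definition has_origin0 L (h : arc L) : Prop :=
  forall u : sg_elt L, u != 0 -> h (mono u) 0%N = 0.

Definition arcs0 L : set (arc L) := [set h | has_origin0 h].

Definition arcs0_star L : set (arc L) :=
  [set h | has_origin0 h /\ forall u : sg_elt L, h (mono u) != 0].

(* the surjection C[L] -> C[L'], for L' the trace of L on theta^perp, that maps
   X^u to X^u if u is in L' and to 0 otherwise *)
Definition to_perp L (theta : set (NR R M)) (a : sg_alg L) : sg_alg (perp L theta) :=
  \sum_(u <- monalg.msupp a)
    oapp (fun v => monalg.mcoeff u a *: mono v) 0 (insub (sg_val u)).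

Definition arcs0_perp L (theta : set (NR R M)) : set (arc L) :=
  [set h : arc L | exists2 g : arc (perp L theta),
    has_origin0 g & forall a, h a = g (to_perp theta a)].
Arguments arcs0 : clear implicits.
Arguments arcs0_star : clear implicits.
Arguments arcs0_perp : clear implicits.

(* the truncation mod t^(s+1) of h, where Spec C[L] is embedded in affine space by
   the minimal generators of L; an s-jet of an affine space is given by the
   coefficients of its coordinates *)
Definition jet L s (h : arc L) : 'rV[C]_(size (min_gens L) * s.+1) :=
  mxvec (\matrix_(i < size (min_gens L), k < s.+1) h (mono (min_gens L)`_i) k).

Definition P_geom L : fps (K0 C) := fun s => K0_class (jet s @` arcs0 L).

Definition nonzero_faces L : set (set (NR R M)) :=
  [set theta | is_face (cone_of R L) theta /\ theta <> [set nu | forall u, nu u = 0]].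

Definition P_sg L : fps (K0 C) := fun s =>
  K0_class (jet s @` arcs0_star L `\`
            \bigcup_(theta in nonzero_faces L) jet s @` arcs0_perp L theta).

End Arcs.

Arguments arcs0 R {M} L.
Arguments arcs0_star R {M} L.
Arguments arcs0_perp {R M} L theta.
Arguments nonzero_faces R {M} L.
Arguments P_geom R {M} L.
Arguments P_sg R {M} L.

(* P of L' = L intersected with theta^perp, for the lattice generated by L' *)
Definition P_perp (R : realType) (M : zmodType) (L : addrClosed M)
    (theta : set (NR R M)) : fps (K0 R[i]) :=
  P_sg R (lat_sg (perp L theta)).

(* Main.v *)
From HB Require Import structures.
From mathcomp Require Import all_boot all_order all_algebra finmap.
From mathcomp Require Import intdiv closed_field.
From mathcomp Require Import boolp classical_sets functions fsbigop cardinality reals complex.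
From mathcomp.multinomials Require Import mpoly.
From mathcomp.multinomials Require monalg.
Require Import Defs.

(** Fix s, and let J be the set of s-jets of arcs of L with origin 0. The
    identity is the additivity of classes of constructible sets, applied to a
    partition of J indexed by the faces theta of the dual cone.

    An arc is the same as a character of L, that is, a multiplicative map chi
    from L to power series, with chi u in the maximal ideal for u <> 0
    ([arc_character], [character_arc]). The u with chi u <> 0 form a face of the
    semigroup L (a subsemigroup containing the summands of its elements), and
    conversely a character of a face extends by 0 to L. By Farkas' lemma the
    faces of the semigroup are exactly the perp L theta ([sface_perp]), and
    theta is determined by perp L theta ([face_perp_inj]).

    The jet x of a character has some nonzero coordinates; let F(x) be the
    smallest face containing the corresponding minimal generators. The pieces
    are the sets of the x in J with F(x) = perp L theta: they are disjoint and
    cover J. An x in J is the jet of an arc of a face T as soon as T contains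
    F(x), because the values of chi outside T may be replaced by 0 without
    changing the jet. Hence, for theta = 0, the piece consists of the jets that
    come from no proper face, and these are automatically jets of arcs with all
    chi u <> 0: this is the set that defines P ([star_jets]). For the other
    theta, the minimal generators of perp L theta are those of L that lie in it,
    so extension of jets by 0 identifies the set that defines P for perp L theta
    with the piece of theta, through a polynomial map that has a polynomial
    retraction ([P_perpE], [K0_class_retract]).

    Additivity needs J to be constructible. A character with support T sends a
    generator g i of T to t ^ a i times a unit; the units form a homomorphism
    from the lattice spanned by T to the units of C[[t]], and as this lattice is
    free, such homomorphisms are freely parametrized by finitely many units.
    Modulo t ^ (s + 1) only finitely many coefficients of these units and
    finitely many truncated exponents a i matter, so J is a finite union of
    images of polynomial maps ([jet_set_constructible]), which are constructible
    by Chevalley's theorem ([constructible_image]). Finally, the class of a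
    constructible set does not depend on the partition chosen to define it
    because two partitions are compared through the cells cut out by all the
    closed sets that occur in them ([lc_class_fpartition_by]). *)


Set Implicit Arguments.
Unset Strict Implicit.
Unset Printing Implicit Defensive.

Import Order.TTheory GRing.Theory Num.Theory.
Local Open Scope classical_set_scope.
Local Open Scope ring_scope.

(** * Polynomial maps between quasi-affine varieties *)

Section PolyMap.
Variable K : closedFieldType.

Definition polymap n m (f : 'rV[K]_n -> 'rV[K]_m) : Prop :=
  forall j, exists p : {mpoly K[n]}, forall x, f x ord0 j = p.@[x ord0].

Lemma polymap_preim_zclosed n m (f : 'rV[K]_n -> 'rV[K]_m) A :
  polymap f -> zclosed A -> zclosed (f @^-1` A).
Proof.
move=> /(_ _)/cid-/all_sig[P hP] [S ->].
exists [set p \mPo [tuple P j | j < m] | p in S].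
have comp p (x : 'rV_n) : (p \mPo [tuple P j | j < m]).@[x ord0] = p.@[f x ord0].
  by rewrite comp_mpoly_meval; apply: meval_eq => j; rewrite tnth_mktuple hP.
apply/seteqP; split => [x /= h _ [p Sp <-]|x /= h p Sp].
  by rewrite comp; apply: h.
by rewrite -comp; apply: h; exists p.
Qed.

Lemma polymap_preim_lc n m (f : 'rV[K]_n -> 'rV[K]_m) A :
  polymap f -> locally_closed A -> locally_closed (f @^-1` A).
Proof.
move=> pf [V [cV [F [cF ->]]]].
exists (f @^-1` V); split; first exact: polymap_preim_zclosed.
by exists (f @^-1` F); split => //; apply: polymap_preim_zclosed.
Qed.

(** A polynomial is a fraction with denominator 1. *)
Lemma polymap_regular n m (f : 'rV[K]_n -> 'rV[K]_m) B :
  polymap f -> regular_map B f.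
Proof.
move=> pf j x _; have [p hp] := pf j.
by exists p, 1; rewrite meval1 oner_neq0; split => // y _ _; rewrite meval1 divr1.
Qed.

Lemma zopen_in_self n (V : set 'rV[K]_n) : zopen_in V V.
Proof. by exists set0; split; [exact: zclosed0|rewrite setD0]. Qed.

Lemma locally_closedI n (A B : set 'rV[K]_n) :
  locally_closed A -> locally_closed B -> locally_closed (A `&` B).
Proof.
move=> [V [cV [F [cF ->]]]] [W [cW [G [cG ->]]]].
exists (V `&` W); split; first exact: zclosedI.
exists (F `|` G); split; first exact: zclosedU.
by apply/seteqP; split => x; rewrite /setI /setD /setU /=; tauto.
Qed.

(** The maps f and g are defined on the whole affine spaces but mutually
    inverse on A and B only, like a projection and an embedding. *)
Lemma qaff_iso n m (A : set 'rV[K]_n) (B : set 'rV[K]_m) lcA lcB f g :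
    polymap f -> polymap g -> (forall x, A x -> B (f x)) -> (forall y, B y -> A (g y)) ->
    (forall x, A x -> g (f x) = x) -> (forall y, B y -> f (g y) = y) ->
  isomorphic (@qaff K n A lcA) (@qaff K m B lcB).
Proof.
move=> pf pg fAB gBA gfK fgK.
have mor n' m' (A' : set 'rV[K]_n') (B' : set 'rV[K]_m') lA lB h : polymap h ->
    (forall x, A' x -> B' (h x)) ->
    is_morphism (@qaff K _ A' lA) (@qaff K _ B' lB)
      (fun x => seq_of_rV (h (rV_of_seq n' x))).
  move=> ph hAB; split=> [_ [i [x Ax <-]]|i j] /=.
    by exists ord0, (h x); [exact: hAB|rewrite seq_of_rVK].
  set D := (X in zopen_in _ X).
  have -> : D = rV_of_seq n' @` (@seq_of_rV K n' @` A').
    apply/seteqP; split => [_ [x [Ax _] <-]|_ [x Ax <-]]; first by exists x.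
    exists x => //; split => //=; case: Ax => z Az <-; rewrite seq_of_rVK.
    by exists (h z) => //; exact: hAB.
  split; first exact: zopen_in_self.
  exists h; split; first exact: polymap_regular.
  by move=> x _ _; rewrite seq_of_rVK.
exists (fun x => seq_of_rV (f (rV_of_seq n x))), (fun x => seq_of_rV (g (rV_of_seq m x))).
split; [exact: mor|exact: mor| |].
  by move=> _ [i [x Ax <-]]; rewrite !seq_of_rVK gfK.
by move=> _ [i [x Ax <-]]; rewrite !seq_of_rVK fgK.
Qed.

(** The two varieties have the same points and the same single chart, so the
    identity is an isomorphism. *)
Lemma subvariety_qaff_iso n (A B : set 'rV[K]_n) lcA lcB A' h :
    (@seq_of_rV K n @` A) `&` A' = @seq_of_rV K n @` B ->
  isomorphic (@subvariety K (@qaff K n A lcA) A' h) (@qaff K n B lcB).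
Proof.
move=> AB.
have BA x : ((@seq_of_rV K n @` A) `&` A') x <-> (@seq_of_rV K n @` B) x by rewrite AB.
exists id, id; split => //; split => [x|i j] /=.
- by move=> [i /BA xi]; exists ord0.
- rewrite preimage_id AB setIid; split; first exact: zopen_in_self.
  by exists id; split => //; exact: regular_id.
- by move=> [i /BA xi]; exists ord0.
- rewrite preimage_id AB setIid; split; first exact: zopen_in_self.
  by exists id; split => //; exact: regular_id.
Qed.

End PolyMap.

(** * The class of a constructible set *)

Section ClassOfConstructible.
Variable K : closedFieldType.
Implicit Types n : nat.

(** Makes it possible to write [A x] for membership in [A : lcset K n]. *)
Definition lcset_mem n (A : lcset K n) (x : 'rV[K]_n) : Prop := lcset_set A x.
Local Coercion lcset_mem : lcset >-> Funclass.

Definition lc_class n (A : lcset K n) : K0 K := K0_of (qaff (lcsetP A)).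

Lemma lc_class_iso n m (A : lcset K n) (B : lcset K m) f g :
    polymap f -> polymap g -> (forall x, A x -> B (f x)) -> (forall y, B y -> A (g y)) ->
    (forall x, A x -> g (f x) = x) -> (forall y, B y -> f (g y) = y) ->
  lc_class A = lc_class B.
Proof. by move=> *; apply: K0_of_iso; apply: qaff_iso; eassumption. Qed.

Lemma polymap_id n : polymap (@id 'rV[K]_n).
Proof. by move=> j; exists 'X_j => x; rewrite mevalXU. Qed.

(** In particular the class does not depend on the proof that the set is
    locally closed. *)
Lemma lc_class_ext n (A B : lcset K n) : (forall x, A x <-> B x) -> lc_class A = lc_class B.
Proof.
by move=> AB; apply: (@lc_class_iso _ _ _ _ id id) => // [||x|x];
  [exact: polymap_id | exact: polymap_id | move/AB | move/AB].
Qed.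

Lemma lc_class_scissor n (A B C : lcset K n) (G : set 'rV[K]_n) : zclosed G ->
    (forall x, B x <-> A x /\ G x) -> (forall x, C x <-> A x /\ ~ G x) ->
  lc_class A = lc_class B + lc_class C.
Proof.
move=> cG hB hC; pose A' := @seq_of_rV K n @` G.
have imI D : rV_of_seq n @` ((@seq_of_rV K n @` D) `&` A') = D `&` G.
  apply/seteqP; split => [_ [_ [[x Dx <-] [y Gy yx]] <-]|x [Dx Gx]].
    by rewrite seq_of_rVK; split => //; rewrite -(can_inj (@seq_of_rVK K n) yx).
  by exists (seq_of_rV x); rewrite ?seq_of_rVK //; split; exists x.
have cA : @vclosed K (qaff (lcsetP A)) A'.
  by move=> i /=; rewrite imI rV_of_seq_image; exists G.
rewrite /lc_class (K0_of_scissor cA); congr (_ + _); apply: K0_of_iso.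
  apply: subvariety_qaff_iso; apply/seteqP; split.
    move=> _ [[x Ax <-] [y Gy /(can_inj (@seq_of_rVK K n)) yx]].
    by exists x => //; apply/hB; split => //; rewrite -yx.
  by move=> _ [x /hB[Ax Gx] <-]; split; exists x.
apply: subvariety_qaff_iso; apply/seteqP; split.
  by move=> _ [[x Ax <-] nG]; exists x => //; apply/hC; split => // Gx; apply: nG; exists x.
move=> _ [x /hC[Ax Gx] <-]; split; first by exists x.
by move=> [y Gy /(can_inj (@seq_of_rVK K n)) yx]; apply: Gx; rewrite -yx.
Qed.

(** The empty set is the disjoint union of two copies of itself. *)
Lemma lc_class_empty n (A : lcset K n) : (forall x, ~ A x) -> lc_class A = 0.
Proof.
move=> A0; apply: (addrI (lc_class A)); rewrite addr0 -(@lc_class_scissor _ A A A setT) //.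
- exact: zclosedT.
- by move=> x; split=> [|[]].
- by move=> x; split=> [/A0|[]].
Qed.

Definition lcI_closed n (A : lcset K n) (G : set 'rV[K]_n) (cG : zclosed G) : lcset K n :=
  LcSet (locally_closedI_closed (lcsetP A) (ex_intro _ G (conj cG erefl))).

Lemma zclosed_in_setI n (A G : set 'rV[K]_n) : zclosed G -> zclosed_in A (A `&` G).
Proof. by move=> cG; exists G. Qed.

Definition lcD_closed n (A : lcset K n) (G : set 'rV[K]_n) (cG : zclosed G) : lcset K n :=
  LcSet (locally_closedD_closed (lcsetP A) (zclosed_in_setI A cG)).

(** The partitions that define [constructible], with any finite index type in
    place of an initial segment of the integers: this makes unions and common
    refinements immediate. *)
Definition lc_fpartition n (A : set 'rV[K]_n) (I : finType) (L : I -> lcset K n) : Prop :=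
  (forall x, A x <-> exists i, L i x) /\ (forall i j x, L i x -> L j x -> i = j).

(** Additivity when membership in each piece is decided by finitely many
    closed sets G t: cutting A and all the pieces by one G t reduces to the
    two sets where that G t no longer distinguishes points, and with no G t
    left a single piece is the whole of A. *)
Lemma lc_class_fpartition_by n (T : finType) (G : T -> set 'rV[K]_n)
    (cG : forall t, zclosed (G t)) (s : seq T) (A : lcset K n) (I : finType)
    (L : I -> lcset K n) :
    lc_fpartition A L ->
    (forall x y, A x -> A y -> (forall t, t \in s -> G t x <-> G t y) ->
       forall i, L i x -> L i y) ->
  lc_class A = \sum_i lc_class (L i).
Proof.
elim: s A L => [|t s IH] A L [AL Ldisj] hL.
  have [[x Ax]|A0] := pselect (exists x, A x); last first.
    rewrite lc_class_empty => [|x Ax]; last by apply: A0; exists x.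
    rewrite big1 // => i _; rewrite lc_class_empty // => x Lx.
    by apply: A0; exists x; apply/AL; exists i.
  have /AL[i Li] := Ax; rewrite (bigD1 i) //= big1 ?addr0 => [|j ji].
    apply: lc_class_ext => y; split => [Ay|Ly]; first exact: (hL x y).
    by apply/AL; exists i.
  apply: lc_class_empty => y Ly; have Ay : A y by apply/AL; exists j.
  have Lj : L j x by apply: (hL y x Ay Ax).
  by move: ji; rewrite (Ldisj _ _ _ Li Lj) eqxx.
pose A1 := lcI_closed A (cG t); pose A2 := lcD_closed A (cG t).
pose L1 i := lcI_closed (L i) (cG t); pose L2 i := lcD_closed (L i) (cG t).
have DE (B : lcset K n) x : lcD_closed B (cG t) x <-> B x /\ ~ G t x.
  by rewrite /= /setD /setI /=; tauto.
have scis B : lc_class B = lc_class (lcI_closed B (cG t)) + lc_class (lcD_closed B (cG t)).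
  by apply: (lc_class_scissor (cG t)).
rewrite scis (IH A1 L1); first rewrite (IH A2 L2); first 1 last.
- split=> [x|i j x /DE[Li _] /DE[Lj _]]; last exact: (Ldisj i j x).
  split=> [/DE[/AL[i Li] nG]|[i /DE[Li nG]]]; first by exists i; apply/DE.
  by apply/DE; split => //; apply/AL; exists i.
- move=> x y /DE[Ax nx] /DE[Ay ny] xy i /DE[Lx _]; apply/DE; split => //.
  apply: (hL x y) => // t'; rewrite inE => /orP[/eqP->|]; [by split|exact: xy].
- split=> [x|i j x [Li _] [Lj _]]; last exact: (Ldisj i j x).
  split=> [[/AL[i Li] Gx]|[i [Li Gx]]]; first by exists i.
  by split => //; apply/AL; exists i.
- move=> x y [Ax Gx] [Ay Gy] xy i [Lx _]; split => //.
  apply: (hL x y) => // t'; rewrite inE => /orP[/eqP->|]; [by split|exact: xy].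
by rewrite -big_split /=; apply: eq_bigr => i _; rewrite -scis.
Qed.

(** A locally closed set is a difference of two closed sets, and these closed
    sets, for all the pieces, decide membership. *)
Lemma lc_class_fpartition n (A : lcset K n) (I : finType) (L : I -> lcset K n) :
  lc_fpartition A L -> lc_class A = \sum_i lc_class (L i).
Proof.
move=> AL; have lcL i : exists VF : set 'rV[K]_n * set 'rV[K]_n,
    [/\ zclosed VF.1, zclosed VF.2 & forall x, L i x <-> VF.1 x /\ ~ VF.2 x].
  have [V [cV [F [cF e]]]] := lcsetP (L i); exists (V, F); split => // x.
  by rewrite /lcset_mem e.
have /all_sig[VF hVF] := fun i => cid (lcL i).
pose G (t : I * bool) := if t.2 then (VF t.1).1 else (VF t.1).2.
have cG t : zclosed (G t) by case: t => i [] /=; have [] := hVF i.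
apply: (lc_class_fpartition_by cG (s := enum {: I * bool}) AL).
move=> x y _ _ xy i; have [_ _ Li] := hVF i.
move=> /Li[Vx Fx]; apply/Li; split.
  by apply/(xy (i, true)) => //; rewrite mem_enum.
by move/(xy (i, false)) => Fy; apply: Fx; apply: Fy; rewrite mem_enum.
Qed.

Definition lcI n (A B : lcset K n) : lcset K n :=
  LcSet (locally_closedI (lcsetP A) (lcsetP B)).

(** Both sums are equal to the sum over the common refinement. *)
Lemma lc_fpartition_uniq n (A : set 'rV[K]_n) (I J : finType) (L : I -> lcset K n)
    (L' : J -> lcset K n) :
  lc_fpartition A L -> lc_fpartition A L' -> \sum_i lc_class (L i) = \sum_j lc_class (L' j).
Proof.
move=> [AL dL] [AL' dL'].
rewrite (eq_bigr (fun i => \sum_j lc_class (lcI (L i) (L' j)))); last first.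
  move=> i _; apply: lc_class_fpartition; split => [x|j k x [_ Lj] [_ Lk]];
    last exact: dL' Lj Lk.
  split => [Lx|[j []//]]; have /AL'[j Lj] : A x by apply/AL; exists i.
  by exists j.
rewrite exchange_big; apply: eq_bigr => j _; apply/esym.
apply: lc_class_fpartition; split => [x|i k x [Lj _] [Lk _]]; last exact: dL Lj Lk.
split => [Lx|[i []//]]; have /AL[i Li] : A x by apply/AL'; exists j.
by exists i.
Qed.

Lemma lc_fpartition_constructible n (A : set 'rV[K]_n) (I : finType) (L : I -> lcset K n) :
  lc_fpartition A L -> constructible A.
Proof.
move=> [AL dL]; exists (existT (fun k => 'I_k -> lcset K n) #|I| (fun i => L (enum_val i)));
  split => /=.
  apply/seteqP; split => [x /AL[i Li]|x [i _ Li]]; last by apply/AL; exists (enum_val i).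
  by exists (enum_rank i) => //=; rewrite enum_rankK.
by move=> i j _ _ [x [Li Lj]]; apply: enum_val_inj; apply: dL Li Lj.
Qed.

Lemma lc_partition_fpartition n (A : set 'rV[K]_n) k (L : 'I_k -> lcset K n) :
  lc_partition A L -> lc_fpartition A L.
Proof.
move=> [-> tL]; split => [x|i j x Li Lj]; last by apply: tL => //; exists x.
by split=> [[i _ Li]|[i Li]]; exists i.
Qed.

Lemma constructibleP n (A : set 'rV[K]_n) :
  constructible A <-> exists (I : finType) (L : I -> lcset K n), lc_fpartition A L.
Proof.
split=> [[L /lc_partition_fpartition AL]|[I [L]]]; last exact: lc_fpartition_constructible.
by exists 'I_(projT1 L), (projT2 L).
Qed.

(** The partition chosen in the definition of the class may be replaced by any
    other one. *)
Lemma K0_class_fpartition n (A : set 'rV[K]_n) (I : finType) (L : I -> lcset K n) :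
  lc_fpartition A L -> K0_class A = \sum_i lc_class (L i).
Proof.
move=> AL; rewrite /K0_class; case: pselect => [cA|]; last first.
  by move=> /(_ (lc_fpartition_constructible AL)).
by apply: lc_fpartition_uniq AL; apply: lc_partition_fpartition; exact: (svalP (cid cA)).
Qed.

Lemma K0_class0 n : K0_class (set0 : set 'rV[K]_n) = 0.
Proof.
rewrite (@K0_class_fpartition _ _ void (fun i => match i with end)).
  by rewrite big1 // => -[].
by split => [x|[]//]; split=> [//|[[]]].
Qed.

Lemma lc_fpartitionU n (A B : set 'rV[K]_n) (I J : finType) (L : I -> lcset K n)
    (L' : J -> lcset K n) : A `&` B = set0 -> lc_fpartition A L -> lc_fpartition B L' ->
  lc_fpartition (A `|` B) (fun k : I + J => match k with inl i => L i | inr j => L' j end).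
Proof.
move=> AB0 [AL dL] [AL' dL'].
have AB x i j : L i x -> L' j x -> False.
  move=> Li Lj; suff : (A `&` B) x by rewrite AB0.
  by split; [apply/AL; exists i|apply/AL'; exists j].
split => [x|[i|i] [j|j] x Li Lj]; last 1 first.
- by rewrite (dL' _ _ _ Li Lj).
- split => [[/AL[i Li]|/AL'[j Lj]]|[[i|j] Lx]]; [by exists (inl i)|by exists (inr j)| |].
    by left; apply/AL; exists i.
  by right; apply/AL'; exists j.
- by rewrite (dL _ _ _ Li Lj).
- by have := AB _ _ _ Li Lj.
- by have := AB _ _ _ Lj Li.
Qed.

Lemma K0_classU n (A B : set 'rV[K]_n) : constructible A -> constructible B ->
  A `&` B = set0 -> K0_class (A `|` B) = K0_class A + K0_class B.
Proof.
move=> /constructibleP[I [L AL]] /constructibleP[J [L' BL']] AB.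
rewrite (K0_class_fpartition AL) (K0_class_fpartition BL') (K0_class_fpartition
  (lc_fpartitionU AB AL BL')).
by rewrite big_sumType.
Qed.

Lemma constructibleU_disj n (A B : set 'rV[K]_n) : constructible A -> constructible B ->
  A `&` B = set0 -> constructible (A `|` B).
Proof.
move=> /constructibleP[I [L AL]] /constructibleP[J [L' BL']] AB.
exact: lc_fpartition_constructible (lc_fpartitionU AB AL BL').
Qed.

Lemma lc_constructible n (A : set 'rV[K]_n) : locally_closed A -> constructible A.
Proof.
move=> lA; apply: (@lc_fpartition_constructible _ _ unit (fun=> LcSet lA)).
by split => [x|[] []//]; split=> [|[]//]; exists tt.
Qed.

Lemma constructible0 n : constructible (set0 : set 'rV[K]_n).
Proof.
apply: (@lc_fpartition_constructible _ _ void (fun i => match i with end)).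
by split => [x|[]//]; split=> [//|[[]]].
Qed.

Lemma constructibleI n (A B : set 'rV[K]_n) :
  constructible A -> constructible B -> constructible (A `&` B).
Proof.
move=> /constructibleP[I [L [AL dL]]] /constructibleP[J [L' [AL' dL']]].
apply: (@lc_fpartition_constructible _ _ (I * J)%type (fun ij => lcI (L ij.1) (L' ij.2))).
split => [x|[i j] [i' j'] x /= [Li Lj] [Li' Lj']].
  split => [[/AL[i Li] /AL'[j Lj]]|[[i j] [Li Lj]]]; first by exists (i, j).
  by split; [apply/AL; exists i|apply/AL'; exists j].
by rewrite (dL _ _ _ Li Li') (dL' _ _ _ Lj Lj').
Qed.

Lemma zclosed_constructible n (A : set 'rV[K]_n) : zclosed A -> constructible A.
Proof.
move=> cA; apply: lc_constructible; exists A; split => //; exact: zopen_in_self.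
Qed.

Lemma zclosedC_constructible n (A : set 'rV[K]_n) : zclosed A -> constructible (~` A).
Proof.
move=> cA; apply: lc_constructible; exists setT; split; first exact: zclosedT.
by exists A; split => //; rewrite setTD.
Qed.

(** V \ F has complement the disjoint union of the complement of V and of the
    intersection of V and F. *)
Lemma constructibleC_lc n (A : set 'rV[K]_n) : locally_closed A -> constructible (~` A).
Proof.
move=> [V [cV [F [cF ->]]]].
have -> : ~` (V `\` F) = ~` V `|` (V `&` F).
  apply/seteqP; split => x; rewrite /setC /setD /setU /setI /=; last tauto.
  by move=> h; have [Vx|] := pselect (V x); have [Fx|] := pselect (F x); tauto.
apply: constructibleU_disj.
- exact: zclosedC_constructible.
- by apply: zclosed_constructible; apply: zclosedI.
- by apply/seteqP; split => x //; rewrite /setC /setI /=; tauto.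
Qed.

Lemma constructible_bigI n (T : Type) (s : seq T) (A : T -> set 'rV[K]_n) :
  (forall t, constructible (A t)) -> constructible (\big[setI/setT]_(t <- s) A t).
Proof.
move=> cA; apply: (big_ind (@constructible K n)) => //.
- exact: zclosed_constructible (@zclosedT K n).
- exact: constructibleI.
Qed.

Lemma constructibleC n (A : set 'rV[K]_n) : constructible A -> constructible (~` A).
Proof.
move=> /constructibleP[I [L [AL _]]].
have -> : ~` A = \big[setI/setT]_(i <- enum I) ~` L i.
  rewrite -bigcap_seq; apply/seteqP; split => x /=.
    by move=> nA i _ Li; apply: nA; apply/AL; exists i.
  by move=> h /AL[i Li]; apply: (h i) Li; rewrite /= mem_enum.
by apply: constructible_bigI => i; apply: constructibleC_lc; apply: lcsetP.
Qed.

Lemma constructibleU n (A B : set 'rV[K]_n) :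
  constructible A -> constructible B -> constructible (A `|` B).
Proof.
by move=> cA cB; rewrite -[A `|` B]setCK setCU; apply/constructibleC/constructibleI;
  apply/constructibleC.
Qed.

Lemma constructible_bigU n (T : Type) (s : seq T) (A : T -> set 'rV[K]_n) :
  (forall t, constructible (A t)) -> constructible (\big[setU/set0]_(t <- s) A t).
Proof.
move=> cA; apply: (big_ind (@constructible K n)) => //.
- exact: constructible0.
- exact: constructibleU.
Qed.

Lemma constructible_finU n (T : finType) (A : T -> set 'rV[K]_n) :
  (forall t, constructible (A t)) -> constructible [set x | exists t, A t x].
Proof.
move=> cA; have -> : [set x | exists t, A t x] = \big[setU/set0]_(t <- enum T) A t.
  rewrite -bigcup_seq; apply/seteqP; split => x /= [t]; last by exists t.
  by exists t => //=; rewrite mem_enum.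
exact: constructible_bigU.
Qed.

Lemma K0_class_bigU n (T : choiceType) (s : seq T) (A : T -> set 'rV[K]_n) :
    uniq s -> (forall t, constructible (A t)) ->
    (forall t u x, t \in s -> u \in s -> A t x -> A u x -> t = u) ->
  K0_class [set x | exists2 t, t \in s & A t x] = \sum_(t <- s) K0_class (A t).
Proof.
move=> us cA; elim: s us => [_ _|t s IH /= /andP[ts us] dA].
  rewrite big_nil -[RHS](K0_class0 n); congr K0_class.
  by apply/seteqP; split => x // [t].
rewrite big_cons -IH //; last first.
  by move=> u v x us' vs'; apply: dA; rewrite inE ?us' ?vs' orbT.
rewrite -K0_classU //.
- congr K0_class; apply/seteqP; split => x /=.
    by move=> [u]; rewrite inE => /orP[/eqP->|]; [left|right; exists u].
  by move=> [|[u us']]; [exists t; rewrite ?mem_head|exists u; rewrite // inE us' orbT].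
- rewrite (_ : [set x | _] = \big[setU/set0]_(u <- s) A u); first exact: constructible_bigU.
  by rewrite -bigcup_seq; apply/seteqP; split => x /= [u]; exists u.
- apply/seteqP; split => x // [At [u us' Au]].
  by move: ts; rewrite (dA t u x) ?us' ?mem_head // inE us' orbT.
Qed.

(** For B0 locally closed contained in the image of f, f and g are inverse to
    each other between B0 and its preimage, so each piece of a partition of
    the image has the class of its preimage. *)
Lemma K0_class_retract n m (f : 'rV[K]_n -> 'rV[K]_m) g B :
    polymap f -> polymap g -> cancel f g -> constructible (f @` B) ->
  K0_class B = K0_class (f @` B).
Proof.
move=> pf pg fK /constructibleP[I [L BL]]; have [fBL dL] := BL.
rewrite (K0_class_fpartition BL).
pose L' i := LcSet (polymap_preim_lc pf (lcsetP (L i))).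
have BL' : lc_fpartition B L'.
  split => [x|i j x]; last exact: dL.
  split=> [Bx|[i /= Li]]; first by apply/fBL; exists x.
  by have /fBL[y By /(can_inj fK) <-] : exists i, L i (f x) by exists i.
rewrite (K0_class_fpartition BL'); apply: eq_bigr => i _.
apply: (@lc_class_iso _ _ _ _ f g) => //=.
  move=> y Ly; have /fBL[x Bx xy] : exists i, L i y by exists i.
  by rewrite -xy fK xy.
move=> y Ly; have /fBL[x Bx <-] : exists i, L i y by exists i.
by rewrite fK.
Qed.

End ClassOfConstructible.

(** * Images of polynomial maps are constructible *)

Section Chevalley.
Variable K : closedFieldType.

Lemma rterm_mpoly n (t : GRing.term K) : GRing.rterm t ->
  exists p : {mpoly K[n]}, forall x : 'rV_n, GRing.eval (seq_of_rV x) t = p.@[x ord0].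
Proof.
elim: t => //=.
- move=> i _; have [lin|lni] := ltnP i n.
    exists 'X_(Ordinal lin) => x; rewrite mevalXU /seq_of_rV.
    rewrite (nth_map (Ordinal lin)) ?size_enum_ord //.
    by congr (x ord0 _); apply: val_inj; rewrite /= nth_enum_ord.
  exists 0 => x; rewrite meval0 nth_default //.
  by rewrite /seq_of_rV size_map size_enum_ord.
- by move=> c _; exists c%:MP => x; rewrite mevalC.
- by move=> k _; exists (k%:R) => x; rewrite mevalMn meval1.
- move=> t IHt u IHu /andP[/IHt[p hp] /IHu[q hq]].
  by exists (p + q) => x; rewrite mevalD hp hq.
- by move=> t IHt /IHt[p hp]; exists (- p) => x; rewrite mevalN hp.
- by move=> t IHt k /IHt[p hp]; exists (p *+ k) => x; rewrite mevalMn hp.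
- move=> t IHt u IHu /andP[/IHt[p hp] /IHu[q hq]].
  by exists (p * q) => x; rewrite mevalM hp hq.
- by move=> t IHt k /IHt[p hp]; exists (p ^+ k) => x; rewrite rmorphXn hp.
Qed.

(** A quantifier-free formula is a boolean combination of polynomial
    equations. *)
Lemma qf_constructible n (f : GRing.formula K) : GRing.qf_form f -> GRing.rformula f ->
  constructible [set x : 'rV[K]_n | GRing.qf_eval (seq_of_rV x) f].
Proof.
elim: f => //=.
- move=> [] _ _; first by rewrite (_ : [set _ | _] = setT);
    [exact/zclosed_constructible/zclosedT|apply/seteqP; split].
  by rewrite (_ : [set _ | _] = set0); [apply: constructible0|apply/seteqP; split].
- move=> t u _ /andP[/(@rterm_mpoly n)[p hp] /(@rterm_mpoly n)[q hq]].
  apply: zclosed_constructible; exists [set p - q]; apply/seteqP; split => x /=.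
    by rewrite hp hq => /eqP e _ ->; rewrite mevalB e subrr.
  by move=> /(_ _ erefl) /eqP; rewrite mevalB subr_eq0 hp hq.
- move=> f IHf g IHg /andP[qf qg] /andP[rf rg].
  have := constructibleI (IHf qf rf) (IHg qg rg); congr constructible.
  by apply/seteqP; split => x /andP.
- move=> f IHf g IHg /andP[qf qg] /andP[rf rg].
  have := constructibleU (IHf qf rf) (IHg qg rg); congr constructible.
  by apply/seteqP; split => x /orP.
- move=> f IHf g IHg /andP[qf qg] /andP[rf rg].
  have := constructibleU (constructibleC (IHf qf rf)) (IHg qg rg); congr constructible.
  apply/seteqP; split => x /=.
    by move=> [/negP/negbTE->|->] //; rewrite implybT.
  by move=> /implyP h; have [/h|/negP] := boolP (GRing.qf_eval (seq_of_rV x) f); [right|left].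
- move=> f IHf qf rf.
  have := constructibleC (IHf qf rf); congr constructible.
  by apply/seteqP; split => x /negP.
Qed.

(** Quantifier elimination over an algebraically closed field. *)
Lemma holds_constructible n (f : GRing.formula K) : GRing.rformula f ->
  constructible [set x : 'rV[K]_n | GRing.holds (seq_of_rV x) f].
Proof.
move=> rf; pose F_closed := @GRing.solve_monicpoly K.
have /andP[qfe rfe] :=
  GRing.quantifier_elim_wf (@ClosedFieldQE.wf_ex_elim K) rf.
have := qf_constructible n qfe rfe; congr constructible.
apply/seteqP; split => x /=.
  by move/(GRing.quantifier_elim_rformP (@ClosedFieldQE.wf_ex_elim K)
    (@ClosedFieldQE.holds_ex_elim K F_closed)); apply.
by move/(GRing.quantifier_elim_rformP (@ClosedFieldQE.wf_ex_elim K)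
    (@ClosedFieldQE.holds_ex_elim K F_closed)); apply.
Qed.

(** Polynomial functions, reified as terms in the variables of index o, .., o
    + m - 1: the offset o leaves room for the variables of the target of a
    map. *)
Definition polyfn m (F : 'rV[K]_m -> K) : Prop :=
  forall o, exists2 t, GRing.rterm t & forall e, GRing.eval e t = F (\row_i e`_(o + i)).

Lemma polyfn_coord m (i : 'I_m) : polyfn (fun x => x ord0 i).
Proof. by move=> o; exists (GRing.Var K (o + i)) => // e /=; rewrite mxE. Qed.

Lemma polyfn_const m c : polyfn (fun _ : 'rV_m => c).
Proof. by move=> o; exists (GRing.Const c). Qed.

Lemma polyfnD m (F G : 'rV[K]_m -> K) : polyfn F -> polyfn G -> polyfn (fun x => F x + G x).
Proof.
move=> pF pG o; have [t rt ht] := pF o; have [u ru hu] := pG o.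
by exists (GRing.Add t u) => [|e] /=; rewrite ?rt ?ht ?hu.
Qed.

Lemma polyfnM m (F G : 'rV[K]_m -> K) : polyfn F -> polyfn G -> polyfn (fun x => F x * G x).
Proof.
move=> pF pG o; have [t rt ht] := pF o; have [u ru hu] := pG o.
by exists (GRing.Mul t u) => [|e] /=; rewrite ?rt ?ht ?hu.
Qed.

Lemma polyfn_sum m (I : Type) (s : seq I) (F : I -> 'rV[K]_m -> K) :
  (forall i, polyfn (F i)) -> polyfn (fun x => \sum_(i <- s) F i x).
Proof.
move=> pF; elim: s => [|i s IH].
  under eq_fun do rewrite big_nil; exact: (polyfn_const m 0).
under eq_fun do rewrite big_cons; exact: (polyfnD (pF i) IH).
Qed.

Lemma holds_all e (I : finType) (f : I -> GRing.formula K) :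
  GRing.holds e (foldr GRing.And (GRing.Bool true) [seq f i | i <- enum I])
    <-> forall i, GRing.holds e (f i).
Proof.
suff h s : GRing.holds e (foldr GRing.And (GRing.Bool true) [seq f i | i <- s])
    <-> forall i, i \in s -> GRing.holds e (f i).
  by rewrite h; split => h' i //; apply: h'; rewrite mem_enum.
elim: s => [//|i s IH /=]; rewrite IH; split=> [[fi fs] j|h].
  by rewrite inE => /orP[/eqP->|/fs].
by split=> [|j js]; apply: h; rewrite inE ?eqxx ?js ?orbT.
Qed.

Lemma rformula_all (I : finType) (f : I -> GRing.formula K) :
  (forall i, GRing.rformula (f i)) ->
  GRing.rformula (foldr GRing.And (GRing.Bool true) [seq f i | i <- enum I]).
Proof. by move=> h; elim: (enum I) => [//|i s IH] /=; rewrite h. Qed.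

(** Chevalley's theorem for the image, under a polynomial map, of a closed set
    given by finitely many equations: membership in the image is expressed by
    an existential formula, whose free variables 0, .., n - 1 are the
    coordinates of the target. *)
Lemma constructible_image n m (I : finType) (Q : I -> 'rV[K]_m -> K)
    (F : 'I_n -> 'rV[K]_m -> K) :
    (forall i, polyfn (Q i)) -> (forall j, polyfn (F j)) ->
  constructible [set y : 'rV[K]_n | exists x : 'rV_m,
    (forall i, Q i x = 0) /\ forall j, y ord0 j = F j x].
Proof.
move=> pQ pF.
have /all_sig2[tq rq hq] : forall i,
    {t | GRing.rterm t & forall e, GRing.eval e t = Q i (\row_k e`_(n + k))}.
  by move=> i; have [t rt ht] := cid2 (pQ i n); exists t.
have /all_sig2[tf rf hf] : forall j,
    {t | GRing.rterm t & forall e, GRing.eval e t = F j (\row_k e`_(n + k))}.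
  by move=> j; have [t rt ht] := cid2 (pF j n); exists t.
pose f0 := GRing.And
  (foldr GRing.And (GRing.Bool true) [seq GRing.Equal (tq i) (GRing.Const 0) | i <- enum I])
  (foldr GRing.And (GRing.Bool true)
     [seq GRing.Equal (GRing.Var K (nat_of_ord j)) (tf j) | j <- enum 'I_n]).
pose f := foldr GRing.Exists f0 (iota n m).
have rf0 : GRing.rformula f.
  rewrite /f; elim: (iota n m) => [|_ l //]; rewrite /f0 /=.
  by rewrite !rformula_all // => i /=; rewrite ?rq ?rf.
have := holds_constructible n rf0; congr constructible.
have snth (x : 'rV[K]_n) (j : 'I_n) : (seq_of_rV x)`_j = x ord0 j.
  by rewrite /seq_of_rV (nth_map j) ?size_enum_ord // nth_ord_enum.
have sn (x : 'rV[K]_n) : size (seq_of_rV x) = n.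
  by rewrite /seq_of_rV size_map size_enum_ord.
apply/seteqP; split => y /=.
  move=> /GRing.foldExistsP[e ee [/holds_all hQ /holds_all hF]].
  exists (\row_k e`_(n + k)); split => [i|j]; first by rewrite -hq; exact: hQ.
  rewrite -hf -[RHS](hF j) /= -ee ?snth // inE mem_iota negb_and -ltnNge.
  by rewrite ltn_ord.
move=> [x [hQ hF]]; apply/GRing.foldExistsP.
pose e := seq_of_rV y ++ seq_of_rV x.
have ex : \row_(k < m) e`_(n + k) = x.
  apply/rowP => k; rewrite mxE /e nth_cat sn ltnNge leq_addr /= addKn.
  by rewrite /seq_of_rV (nth_map k) ?size_enum_ord // nth_ord_enum.
exists e.
  move=> k; rewrite inE mem_iota negb_and -ltnNge -leqNgt => kn.
  rewrite /e nth_cat sn; case: ltnP => // lnk.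
  move: kn; rewrite ltnNge lnk /= => lk; rewrite !nth_default ?sn //.
  by rewrite /seq_of_rV size_map size_enum_ord leq_subRL.
split; [apply/holds_all => i|apply/holds_all => j] => /=; first by rewrite hq ex hQ.
by rewrite hf ex -hF /e nth_cat sn ltn_ord snth.
Qed.

End Chevalley.

(** * Units and orders of power series *)

Section FpsRing.
Variable A : comNzRingType.
Implicit Types f g h : fps A.

Lemma fpsM0 f g : (f * g) 0%N = f 0%N * g 0%N.
Proof. by rewrite /GRing.mul /= /fps_mul big_ord1. Qed.

Lemma fps1E n : (1 : fps A) n = (n == 0%N)%:R. Proof. by []. Qed.

Definition fpsX : fps A := fun n => (n == 1%N)%:R.

Lemma fpsXM f n : (fpsX * f) n = if n is m.+1 then f m else 0.
Proof.
rewrite /GRing.mul /= /fps_mul; case: n => [|n]; first by rewrite big_ord1 mul0r.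
rewrite big_ord_recl mul0r add0r big_ord_recl /= mul1r subSS subn0.
by rewrite big1 ?addr0 // => i _; rewrite mul0r.
Qed.

Lemma fpsXnM a f n : (fpsX ^+ a * f) n = if (n < a)%N then 0 else f (n - a)%N.
Proof.
elim: a n => [|a IH] n; first by rewrite expr0 mul1r subn0.
by rewrite exprS -mulrA fpsXM; case: n => [|n]; rewrite ?ltn0Sn // IH subSS ltnS.
Qed.

(** Congruence modulo t ^ (s + 1). *)
Definition fps_cong s f g : Prop := forall k, (k <= s)%N -> f k = g k.

Lemma fps_congM s f g f' g' :
  fps_cong s f f' -> fps_cong s g g' -> fps_cong s (f * g) (f' * g').
Proof.
move=> ff gg k ks; rewrite /GRing.mul /= /fps_mul; apply: eq_bigr => i _.
rewrite ff; last by rewrite (leq_trans _ ks) // -ltnS.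
by rewrite gg // (leq_trans (leq_subr _ _)).
Qed.

Lemma fps_congX s f g n : fps_cong s f g -> fps_cong s (f ^+ n) (g ^+ n).
Proof. by move=> fg; elim: n => [//|n IH]; rewrite !exprS; exact: fps_congM. Qed.

Lemma fps_cong_prod s (I : finType) (F G : I -> fps A) :
  (forall i, fps_cong s (F i) (G i)) -> fps_cong s (\prod_i F i) (\prod_i G i).
Proof.
move=> FG; apply: (big_ind2 (fps_cong s)) => // f f' g g'; exact: fps_congM.
Qed.

(** The coefficients of the inverse are computed one after the other, from the
    list of the previous ones. *)
Lemma fps_inverse f c : c * f 0%N = 1 -> exists g, g * f = 1.
Proof.
move=> cf.
(* s lists the coefficients of index less than size s *)
pose step (s : seq A) : A := - c * \sum_(i < size s) s`_i * f (size s - i)%N.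
pose coefs n := iter n (fun s => rcons s (step s)) [:: c].
have sz n : size (coefs n) = n.+1 by elim: n => [//|n /= IH]; rewrite size_rcons IH.
pose g : fps A := fun n => (coefs n)`_n.
have gE m n : (m <= n)%N -> (coefs n)`_m = g m.
  elim: n => [|n IH]; first by rewrite leqn0 => /eqP->.
  rewrite leq_eqVlt => /orP[/eqP->//|mn]; rewrite /= nth_rcons sz mn.
  by rewrite IH // -ltnS.
exists g; apply/funext => -[|n]; first by rewrite fpsM0.
rewrite fps1E /GRing.mul /= /fps_mul big_ord_recr /= subnn.
rewrite [g n.+1]/g /= nth_rcons sz ltnn eqxx /step sz !mulNr mulrAC cf mul1r.
apply/eqP; rewrite subr_eq0; apply/eqP/eq_bigr => i _.
by rewrite gE // -ltnS.
Qed.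

End FpsRing.

Arguments fpsX {A}.

Section FpsField.
Variable K : fieldType.
Implicit Types f g h : fps K.

Definition fps_unit : {pred fps K} := fun f => f 0%N != 0.
Definition fps_inv f : fps K :=
  if pselect (exists g, g * f = 1) is left h then sval (cid h) else f.

Lemma fps_unitP f : f \in fps_unit -> exists g, g * f = 1.
Proof. by move=> f0; apply: (@fps_inverse _ f (f 0%N)^-1); rewrite mulVf. Qed.

Lemma fps_mulVr : {in fps_unit, left_inverse 1 fps_inv *%R}.
Proof.
move=> f uf; rewrite /fps_inv; case: pselect => [h|[]]; last exact: fps_unitP.
exact: (svalP (cid h)).
Qed.

Lemma fps_unitPl f g : g * f = 1 -> f \in fps_unit.
Proof.
move=> /(congr1 (fun h : fps K => h 0%N)); rewrite fpsM0 fps1E eqxx => gf.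
by apply/eqP => f0; move/eqP: gf; rewrite f0 mulr0 eq_sym oner_eq0.
Qed.

Lemma fps_inv_out : {in [predC fps_unit], fps_inv =1 id}.
Proof.
move=> f nu; rewrite /fps_inv; case: pselect => // -[g gf].
by move: nu; rewrite inE /= (fps_unitPl gf).
Qed.

HB.instance Definition _ := GRing.ComNzRing_hasMulInverse.Build (fps K)
  fps_mulVr fps_unitPl fps_inv_out.

Lemma fps_unitE f : (f \is a GRing.unit) = (f 0%N != 0). Proof. by []. Qed.

Lemma fps_order f : f != 0 -> exists a g, g \is a GRing.unit /\ f = fpsX ^+ a * g.
Proof.
move=> f0; have ex : exists n, f n != 0.
  apply: contrapT => h; move/eqP: f0; apply; apply/funext => n.
  by apply/eqP/negPn/negP => fn; apply: h; exists n.
pose a := ex_minn ex; exists a, (fun n => f (a + n)%N).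
rewrite fps_unitE addn0 /a; case: ex_minnP => m fm mmin; split => //.
apply/funext => n; rewrite fpsXnM; case: ltnP => [nm|mn]; last by rewrite subnKC.
by apply/eqP/negPn/negP => /mmin; rewrite leqNgt nm.
Qed.

Lemma fpsX_unit_inj a b f g : f \is a GRing.unit -> g \is a GRing.unit ->
  fpsX ^+ a * f = fpsX ^+ b * g -> a = b /\ f = g.
Proof.
have main a' b' (f' g' : fps K) : f' \is a GRing.unit ->
    fpsX ^+ a' * f' = fpsX ^+ b' * g' -> (b' <= a')%N.
  move=> uf e; rewrite leqNgt; apply/negP => ab.
  have := congr1 (fun h : fps K => h a') e; rewrite !fpsXnM ltnn ab subnn.
  by move/eqP; apply/negP.
move=> uf ug e; have ab : a = b.
  by apply/eqP; rewrite eqn_leq (main _ _ _ _ ug (esym e)) (main _ _ _ _ uf e).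
split => //; apply/funext => n.
have := congr1 (fun h : fps K => h (n + a)%N) e.
by rewrite !fpsXnM -ab ltnNge leq_addl /= addnK.
Qed.

Lemma fpsXM_neq0 a f : f \is a GRing.unit -> fpsX ^+ a * f != 0.
Proof.
move=> uf; apply/eqP => /(congr1 (fun h : fps K => h a)).
by rewrite fpsXnM ltnn subnn; apply/eqP.
Qed.

Lemma fps_mulf_neq0 f g : f != 0 -> g != 0 -> f * g != 0.
Proof.
move=> /fps_order[a [u [uu ->]]] /fps_order[b [v [uv ->]]].
by rewrite mulrACA -exprD; apply: fpsXM_neq0; rewrite unitrM uu uv.
Qed.

End FpsField.

(** * The universal property of the monoid algebra *)

Section MonoidAlgebraMorphism.
Variables (K : comNzRingType) (N : nmodType).
Notation KN := (monoid_alg K N).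
Import monalg.

Lemma monoid_alg_ext (V : zmodType) (F G : KN -> V) :
  {morph F : x y / x + y} -> {morph G : x y / x + y} ->
  (forall c u, F (mkmalgU u c) = G (mkmalgU u c)) -> F =1 G.
Proof.
move=> addF addG FG.
have F0 (H : KN -> V) : {morph H : x y / x + y} -> H 0 = 0.
  by move=> addH; apply: (addrI (H 0)); rewrite -addH !addr0.
move=> a; rewrite (monalgE a) (big_morph F addF (F0 F addF)).
by rewrite (big_morph G addG (F0 G addG)); apply: eq_bigr => u _; apply: FG.
Qed.

Lemma mkmalgU_scale (u : N) (c : K) : mkmalgU u c = c *: (mono u : KN).
Proof. by apply/malgP => v; rewrite mcoeffZ !mcoeffU mulrnAr mulr1. Qed.

Definition lin_ext (V : lmodType K) (F : N -> V) (a : KN) : V :=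
  \sum_(u <- msupp a) mcoeff u a *: F u.

Section LinExt.
Variables (V : lmodType K) (F : N -> V).

Lemma lin_extw (d : {fset N}) a : fsubset (msupp a) d ->
  lin_ext F a = \sum_(u <- d) mcoeff u a *: F u.
Proof.
move=> ad; rewrite /lin_ext (big_fset_incl _ ad) // => u _ /mcoeff_outdom ->.
by rewrite scale0r.
Qed.

Lemma lin_extD : {morph lin_ext F : x y / x + y}.
Proof.
move=> a b; rewrite (lin_extw (msuppD_le a b)).
rewrite (lin_extw (fsubsetUl (msupp a) (msupp b))).
rewrite (lin_extw (fsubsetUr (msupp a) (msupp b))) -big_split.
by apply: eq_bigr => u _; rewrite mcoeffD scalerDl.
Qed.

Lemma lin_extU u c : lin_ext F (mkmalgU u c) = c *: F u.
Proof. by rewrite (lin_extw msuppU_le) big_seq_fset1 mcoeffUU. Qed.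

Lemma lin_ext_mono u : lin_ext F (mono u) = F u.
Proof. by rewrite lin_extU scale1r. Qed.

Lemma lin_extZ c : {morph lin_ext F : x / c *: x}.
Proof.
apply: monoid_alg_ext => [x y|x y|k u]; rewrite ?scalerDr ?lin_extD ?scalerDr //.
rewrite (mkmalgU_scale u k) scalerA -!mkmalgU_scale.
by rewrite !lin_extU scalerA.
Qed.

End LinExt.

Variables (F : N -> fps K) (F0 : F 0 = 1) (FD : {morph F : u v / u + v >-> u * v}).

Lemma fps_scaleAr (c : K) (f g : fps K) : f * (c *: g) = c *: (f * g).
Proof. by rewrite mulrC -scalerAl mulrC. Qed.

Lemma lin_ext_mul : {morph lin_ext F : x y / x * y}.
Proof.
move=> a b; move: a.
apply: (@monoid_alg_ext _ (fun x => lin_ext F (x * b)) (fun x => lin_ext F x * lin_ext F b)).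
- by move=> x y; rewrite mulrDl lin_extD.
- by move=> x y; rewrite lin_extD mulrDl.
move=> c u; move: b.
apply: (@monoid_alg_ext _ (fun x : KN => lin_ext F ((mkmalgU u c : KN) * x))
   (fun x : KN => lin_ext F (mkmalgU u c) * lin_ext F x)).
- by move=> x y; rewrite mulrDr lin_extD.
- by move=> x y; rewrite lin_extD mulrDr.
move=> k v; rewrite {1}/GRing.mul /= malg_mulUU !lin_extU FD.
by rewrite -scalerAl fps_scaleAr scalerA.
Qed.

Lemma lin_ext_one : lin_ext F 1 = 1.
Proof. by rewrite lin_ext_mono F0. Qed.

Lemma lin_ext_sub : {morph lin_ext F : x y / x - y}.
Proof. by move=> x y; rewrite lin_extD -[in LHS]scaleN1r lin_extZ scaleN1r. Qed.

Definition alg_ext : {lrmorphism KN -> fps K} :=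
  HB.pack_for {lrmorphism KN -> fps K} (lin_ext F)
    (GRing.isZmodMorphism.Build KN (fps K) (lin_ext F) lin_ext_sub)
    (GRing.isMonoidMorphism.Build KN (fps K) (lin_ext F) (lin_ext_one, lin_ext_mul))
    (GRing.isScalable.Build K KN (fps K) *:%R (lin_ext F) (lin_extZ F)).

Lemma alg_ext_mono u : alg_ext (mono u) = F u.
Proof. exact: lin_ext_mono. Qed.

End MonoidAlgebraMorphism.

(** * Integer relations between generators *)

Section Smith.

(** The rows of A span a free group. The matrix U expresses these rows in a
    basis and V expresses the basis in terms of the rows: this is the second
    property, while the first says that linear relations between the rows are
    relations between their coordinates. Both are read off the Smith normal
    form A = L D R, with V the inverse of L and U obtained from L by killing
    the columns that correspond to null rows of D. *)
Lemma int_mx_retract n d (A : 'M[int]_(n, d)) : exists U V : 'M[int]_n,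
  (forall c : 'rV_n, c *m A = 0 -> c *m U = 0) /\ U *m V *m A = A.
Proof.
have [L uL [R uR [dd _ eA]]] := int_Smith_normal_form A.
set D := \matrix_(i, j) _ in eA.
pose J : 'M[int]_n := \matrix_(i, j) ((i == j) && [exists k, D i k != 0])%:R.
have JE m (B : 'M_(m, n)) i j : (B *m J) i j = if [exists k, D j k != 0] then B i j else 0.
  rewrite mxE (bigD1 j) //= big1 ?addr0 => [|k kj].
    by rewrite mxE eqxx /=; case: ifP => _; rewrite ?mulr1 ?mulr0.
  by rewrite mxE (negPf kj) mulr0.
exists (L *m J), (invmx L); split=> [c cA|]; last first.
  rewrite {1}eA !mulmxA mulmxKV // [RHS]eA; congr (_ *m _).
  rewrite -!mulmxA; congr (_ *m _); apply/matrixP => i k.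
  rewrite mxE (bigD1 i) //= big1 ?addr0 => [|j ji].
    rewrite mxE eqxx /=; case: existsP => [_|h]; rewrite ?mul1r ?mul0r //.
    by apply/esym/eqP/negPn/negP => Dk; apply: h; exists k.
  by rewrite mxE eq_sym (negPf ji) mul0r.
have cLD : c *m L *m D = 0.
  apply: (can_inj (mulmxK uR)); rewrite mul0mx -[RHS]cA eA.
  by rewrite !mulmxA.
rewrite mulmxA; apply/rowP => j; rewrite JE [RHS]mxE; case: ifP => [/existsP[k Djk]|//].
have := congr1 (fun B : 'M_(1, d) => B ord0 k) cLD; rewrite mxE mxE (bigD1 j) //=.
have jk : j = k :> nat.
  by move: Djk; rewrite mxE; case: (nat_of_ord j =P k) => //= _; rewrite mulr0n eqxx.
rewrite big1 ?addr0 => [|i ij].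
  by move/eqP; rewrite mulf_eq0 (negPf Djk) orbF => /eqP.
rewrite [D i k]mxE -jk; case: (nat_of_ord i =P j) => [/val_inj e|_] /=;
  last by rewrite mulr0n mulr0.
by move: ij; rewrite e eqxx.
Qed.

End Smith.

(** * Faces and characters of a semigroup *)

Section NatSpan.
Variable M : zmodType.

Definition nspan n (g : 'I_n -> M) (P : {pred 'I_n}) : set M :=
  [set u | exists c : 'I_n -> nat, u = \sum_(i in P) g i *+ c i].

Variables (n : nat) (g : 'I_n -> M).
Implicit Types (P : {pred 'I_n}) (u v : M).

Lemma nspan0 P : nspan g P 0.
Proof. by exists (fun=> 0%N); rewrite big1. Qed.

Lemma nspanD P u v : nspan g P u -> nspan g P v -> nspan g P (u + v).
Proof.
move=> [c ->] [d ->]; exists (fun i => c i + d i)%N.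
by rewrite -big_split; apply: eq_bigr => i _; rewrite mulrnDr.
Qed.

Lemma nspan_gen P i : i \in P -> nspan g P (g i).
Proof.
move=> iP; exists (fun j => (j == i)%N); rewrite (bigD1 i) //= eqxx mulr1n.
by rewrite big1 ?addr0 // => j /andP[_ /negPf->].
Qed.

Lemma nspan_sub P (T : set M) : T 0 -> (forall u v, T u -> T v -> T (u + v)) ->
  (forall i, i \in P -> T (g i)) -> nspan g P `<=` T.
Proof.
move=> T0 TD Tg u [c ->]; apply: (big_ind T) => // i iP.
by elim: (c i) => [|k IH]; rewrite ?mulr0n // mulrS; apply: TD => //; exact: Tg.
Qed.

Lemma nspanT u : nspan g predT u <-> exists c : 'I_n -> nat, u = \sum_i g i *+ c i.
Proof. by split=> -[c ->]; exists c; apply: eq_bigl. Qed.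

Lemma nspanS P (Q : {pred 'I_n}) : {subset P <= Q} -> nspan g P `<=` nspan g Q.
Proof.
move=> PQ; apply: nspan_sub; [exact: nspan0|exact: nspanD|move=> i /PQ; exact: nspan_gen].
Qed.

Lemma nspanMn P u k : nspan g P u -> nspan g P (u *+ k).
Proof.
by move=> Pu; elim: k => [|k IH]; [rewrite mulr0n; exact: nspan0|rewrite mulrS; exact: nspanD].
Qed.

Lemma nspan_sum (I : finType) (Q : {pred I}) (f : I -> M) P :
  (forall i, i \in Q -> nspan g P (f i)) -> nspan g P (\sum_(i in Q) f i).
Proof. by move=> h; apply: big_ind => //; [exact: nspan0|exact: nspanD]. Qed.

(** T is a face of the semigroup S: a subsemigroup that contains the summands,
    in S, of its elements. *)
Definition is_sface (S T : set M) : Prop :=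
  [/\ T `<=` S, T 0, (forall u v, T u -> T v -> T (u + v)) &
      forall u v, S u -> S v -> T (u + v) -> T u].

Lemma sface_sum (S T : set M) : is_sface S T -> nspan g predT = S ->
  forall c : 'I_n -> nat, T (\sum_i g i *+ c i) -> forall i, (0 < c i)%N -> T (g i).
Proof.
move=> [TS T0 TD Tdiv] gS c Tc i ci.
have Sg j : S (g j) by rewrite -gS; apply: nspan_gen.
apply: (Tdiv _ (g i *+ (c i).-1 + \sum_(j | j != i) g j *+ c j)) => //.
  rewrite -gS; apply: nspanD; first by apply: nspanMn; apply: nspan_gen.
  by apply: nspan_sum => j _; apply: nspanMn; apply: nspan_gen.
by move: Tc; rewrite (bigD1 i) //= addrA -mulrS prednK.
Qed.

(** A generator that occurs in an element of a face lies in this face. *)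
Lemma sface_span (S T : set M) : is_sface S T -> nspan g predT = S ->
  T = nspan g (fun i => `[< T (g i) >]).
Proof.
move=> fT gS; have [TS T0 TD _] := fT; apply/seteqP; split => u.
  move=> Tu; have := TS _ Tu; rewrite -gS => /nspanT[c uc]; exists c.
  rewrite uc [RHS]big_mkcond /=; apply: eq_bigr => i _.
  rewrite unfold_in; case: asboolP => // nT.
  case: (posnP (c i)) => [->|ci]; first by rewrite mulr0n.
  by case: nT; apply: (sface_sum fT gS _ ci); rewrite -uc.
by apply: nspan_sub => // i; rewrite unfold_in => /asboolP.
Qed.

End NatSpan.

Section Characters.
Variables (K : fieldType) (M : zmodType).
Implicit Types (S T : set M) (chi : M -> fps K).

(** The arcs with origin 0 of the spectrum of the semigroup algebra of S,
    given by their values on monomials; values outside S are arbitrary. *)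
Definition character S chi : Prop :=
  [/\ chi 0 = 1, forall u v, S u -> S v -> chi (u + v) = chi u * chi v &
      forall u, S u -> u <> 0 -> chi u 0%N = 0].

Definition jet_row n s (x : 'I_n -> fps K) : 'rV[K]_(n * s.+1) :=
  mxvec (\matrix_(i < n, k < s.+1) x i k).

Definition jet_set S n (g : 'I_n -> M) s : set 'rV[K]_(n * s.+1) :=
  [set x | exists2 chi, character S chi & x = jet_row s (chi \o g)].

Local Arguments jet_set S {n} g s _.

Lemma vec_jet_row n s (x : 'I_n -> fps K) i k : vec_mx (jet_row s x) i k = x i k.
Proof. by rewrite mxvecK mxE. Qed.

Lemma character_sum S chi n (g : 'I_n -> M) (P : {pred 'I_n}) (c : 'I_n -> nat) :
    character S chi -> nspan g P `<=` S ->
  chi (\sum_(i in P) g i *+ c i) = \prod_(i in P) chi (g i) ^+ c i.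
Proof.
move=> [chi0 chiD _] gS.
have Sg i k : i \in P -> S (g i *+ k).
  by move=> iP; apply: gS; apply: nspanMn; apply: nspan_gen.
have chiX i k : i \in P -> chi (g i *+ k) = chi (g i) ^+ k.
  move=> iP; elim: k => [|k IH]; first by rewrite mulr0n.
  by rewrite mulrS chiD ?IH ?exprS //; [exact: (Sg i 1%N)|exact: Sg].
pose R u y := (nspan g P u) /\ chi u = y.
suff [] : R (\sum_(i in P) g i *+ c i) (\prod_(i in P) chi (g i) ^+ c i) by [].
apply: (big_ind2 R) => [|u y v z [uP <-] [vP <-]|i iP].
- by split; [exact: nspan0|].
- by split; [exact: nspanD|rewrite chiD //; exact: gS].
split; last exact: chiX.
by apply: nspanMn; apply: nspan_gen.
Qed.

(** Power series over a field form an integral domain. *)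
Lemma character_sface S chi : S 0 -> (forall u v, S u -> S v -> S (u + v)) ->
  character S chi -> is_sface S [set u | S u /\ chi u != 0].
Proof.
move=> S0 SD [chi0 chiD _]; split => [u []//| |u v [Su nu] [Sv nv]|u v Su Sv [_]] /=.
- by split => //; rewrite chi0 oner_neq0.
- by split; [exact: SD|rewrite chiD // fps_mulf_neq0].
- by rewrite chiD // => h; split => //; apply: contraNneq h => ->; rewrite mul0r.
Qed.

(** This is where the summand property of faces is needed: if u is not in T
    then u + v is not either, and both sides vanish. *)
Lemma character_ext S T chi : is_sface S T -> character T chi ->
  character S (fun u => if `[< T u >] then chi u else 0).
Proof.
move=> [TS T0 TD Tdiv] [chi0 chiD chi1]; split => [|u v Su Sv|u Su u0] /=.
- by rewrite asboolT.
- case: (asboolP (T u)) => Tu; last first.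
    by rewrite mul0r asboolF // => Tuv; apply: Tu; apply: Tdiv Tuv.
  case: (asboolP (T v)) => Tv; first by rewrite asboolT ?chiD //; exact: TD.
  rewrite mulr0 asboolF // => Tuv; apply: Tv; apply: (Tdiv _ u) => //.
  by rewrite addrC.
- by case: asboolP => // Tu; exact: chi1.
Qed.

Lemma character_res S T chi : T `<=` S -> character S chi -> character T chi.
Proof.
by move=> TS [c0 cD c1]; split => // [u v Tu Tv|u Tu]; [apply: cD|apply: c1]; apply: TS.
Qed.

End Characters.

Arguments jet_set {K M} S {n} g s _.

(** * The set of jets is constructible *)

Section PolyFps.
Variables (K : closedFieldType) (m : nat).
Implicit Types F G : 'rV[K]_m -> fps K.

Definition polyfps F : Prop := forall k, polyfn (fun x => F x k).

Lemma polyfps_const f : polyfps (fun=> f).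
Proof. by move=> k; exact: polyfn_const. Qed.

Lemma polyfpsM F G : polyfps F -> polyfps G -> polyfps (fun x => F x * G x).
Proof. by move=> pF pG k; apply: polyfn_sum => i; exact: polyfnM. Qed.

Lemma polyfpsX F n : polyfps F -> polyfps (fun x => F x ^+ n).
Proof.
move=> pF; elim: n => [|n IH]; first exact: polyfps_const.
under eq_fun do rewrite exprS; exact: (polyfpsM pF IH).
Qed.

Lemma polyfps_prod (I : Type) (s : seq I) (F : I -> 'rV[K]_m -> fps K) :
  (forall i, polyfps (F i)) -> polyfps (fun x => \prod_(i <- s) F i x).
Proof.
move=> pF; elim: s => [|i s IH].
  under eq_fun do rewrite big_nil; exact: (polyfps_const 1).
under eq_fun do rewrite big_cons; exact: (polyfpsM (pF i) IH).
Qed.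

End PolyFps.

(** For w' inverse to w this is w ^ z; unlike w ^ z it is a polynomial
    expression in w and w'. *)
Definition ipow (R : pzSemiRingType) (w w' : R) (z : int) : R :=
  match z with Posz k => w ^+ k | Negz k => w' ^+ k.+1 end.

Lemma ipowE (R : unitRingType) (w : R) z : ipow w w^-1 z = w ^ z.
Proof. by case: z => k //=; rewrite exprVn. Qed.

Section Units.
Variable R : comUnitRingType.

Definition mexp (I : finType) (w : I -> R) (c : I -> int) : R := \prod_i w i ^ c i.

Lemma mexp_unit (I : finType) (w : I -> R) c :
  (forall i, w i \is a GRing.unit) -> mexp w c \is a GRing.unit.
Proof. by move=> uw; apply: rpred_prod => i _; apply: unitrXz. Qed.

Lemma exprz_sum (I : finType) (w : R) (c : I -> int) : w \is a GRing.unit ->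
  w ^ (\sum_i c i) = \prod_i w ^ c i.
Proof.
move=> uw; apply: (big_morph (fun z => w ^ z)) => // x y; exact: exprzDr.
Qed.

Lemma exprz_prod (I : finType) (w : I -> R) (z : int) : (forall i, w i \is a GRing.unit) ->
  (\prod_i w i) ^ z = \prod_i w i ^ z.
Proof.
move=> uw; pose Q (x y : R) := x \is a GRing.unit /\ x ^ z = y.
suff [] : Q (\prod_i w i) (\prod_i w i ^ z) by [].
apply: (big_ind2 Q) => [|x y x' y' [ux <-] [ux' <-]|i _]; rewrite /Q.
- by rewrite unitr1 exp1rz.
- by split; [rewrite unitrM ux|apply: exprMz_comm => //; exact: mulrC].
- by [].
Qed.

End Units.

Section ConstructibleJets.
Variables (K : closedFieldType) (M : zmodType) (d n s : nat).
Variables (e : {additive M -> 'rV[int]_d}) (e_inj : injective e).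
Variables (g : 'I_n -> M) (g_neq0 : forall i, g i <> 0).

Let S := nspan g predT.

(** The rows outside P are null: in this way the size of the matrix does not
    depend on P. *)
Let A (P : {set 'I_n}) : 'M[int]_(n, d) := \matrix_(i, j) ((i \in P)%:R * e (g i) ord0 j).

Lemma gen_mxP (P : {set 'I_n}) (c : 'rV[int]_n) :
  e (\sum_(i in P) g i *~ c ord0 i) = c *m A P.
Proof.
apply/rowP => j; rewrite raddf_sum summxE !mxE big_mkcond /=; apply: eq_bigr => i _.
rewrite !mxE; case: (i \in P); rewrite ?mul0r ?mulr0 // mul1r raddfMz.
by rewrite -scaler_int mxE intz.
Qed.


(** As e is injective, the relations between the g i, i in P, are those
    between the rows of A P. *)
Lemma relation_mx (P : {set 'I_n}) (c c' : 'I_n -> nat) :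
  \sum_(i in P) g i *+ c i = \sum_(i in P) g i *+ c' i <->
  (\row_i ((c i)%:Z - (c' i)%:Z)) *m A P = 0.
Proof.
rewrite -gen_mxP -[X in _ <-> _ = X](raddf0 e).
have -> : \sum_(i in P) g i *~ (\row_i0 ((c i0)%:Z - (c' i0)%:Z)) ord0 i =
    \sum_(i in P) g i *+ c i - \sum_(i in P) g i *+ c' i.
  by rewrite -sumrB; apply: eq_bigr => i _; rewrite mxE mulrzBr.
split=> [->|/e_inj/eqP]; first by rewrite subrr.
by rewrite subr_eq0 => /eqP.
Qed.

Lemma int_pos_neg (z : int) : exists a b : nat, z = a%:Z - b%:Z.
Proof. by case: z => k; [exists k, 0%N; rewrite subr0|exists 0%N, k.+1; rewrite sub0r NegzE].
  Qed.

(** A relation between generators, written with coefficients p - q with p and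
    q in nat, says that chi has the same value on two elements of S; comparing
    orders and unit parts gives the two conclusions. *)
Lemma character_relation (chi : M -> fps K) (P : {set 'I_n})
    (a : 'I_n -> nat) (w : 'I_n -> fps K) :
    character S chi ->
    (forall i, w i \is a GRing.unit) ->
    (forall i, i \in P -> chi (g i) = fpsX ^+ a i * w i) ->
    (forall i, i \notin P -> a i = 0%N /\ w i = 1) ->
  forall c : 'rV_n, c *m A P = 0 ->
    \sum_i c ord0 i * (a i)%:Z = 0 /\ mexp w (c ord0) = 1.
Proof.
move=> chiS uw chiP chiNP c cA.
have /all_sig2[p /(_ _)/cid-/all_sig[q pq] _] : forall i,
    {p : nat | exists q : nat, c ord0 i = p%:Z - q%:Z & True}.
  by move=> i; have /cid[p hp] := int_pos_neg (c ord0 i); exists p.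
have gS : nspan g (mem P) `<=` S by apply: nspanS.
have chisum b : chi (\sum_(i in P) g i *+ b i) =
    fpsX ^+ (\sum_i a i * b i) * \prod_i w i ^+ b i.
  rewrite (character_sum b chiS gS) -prodrXr -big_split /= big_mkcond /=.
  apply: eq_bigr => i _; case: ifP => [iP|/negbT iP].
    by rewrite chiP // exprMn exprM.
  by have [-> ->] := chiNP i iP; rewrite mul0n expr0 expr1n mulr1.
have : \sum_(i in P) g i *+ p i = \sum_(i in P) g i *+ q i.
  apply/relation_mx; rewrite -[RHS]cA; congr (_ *m _); apply/rowP => i.
  by rewrite mxE pq.
move=> /(congr1 chi); rewrite !chisum => /fpsX_unit_inj[||spq wpq].
- by apply: rpred_prod => i _; rewrite rpredX.
- by apply: rpred_prod => i _; rewrite rpredX.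
split.
  under eq_bigr do rewrite pq mulrBl -!PoszM mulnC (mulnC (q _)).
  rewrite sumrB -!(big_morph Posz PoszD (erefl (Posz 0))) spq subrr //.
have wq : \prod_i w i ^+ q i \is a GRing.unit by apply: rpred_prod => i _; rewrite rpredX.
apply: (mulIr wq); rewrite mul1r -[RHS]wpq /mexp -big_split; apply: eq_bigr => i _ /=.
by rewrite pq (_ : w i ^+ q i = w i ^ (q i)%:Z) // -exprzDr // subrK.
Qed.

Let U (P : {set 'I_n}) : 'M[int]_n := sval (cid (int_mx_retract (A P))).
Let V (P : {set 'I_n}) : 'M[int]_n := sval (cid (svalP (cid (int_mx_retract (A P))))).

Let UP (P : {set 'I_n}) (c : 'rV_n) : c *m A P = 0 -> c *m U P = 0.
Proof. by have [] := svalP (cid (svalP (cid (int_mx_retract (A P))))) => + _; apply. Qed.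

Let UVA (P : {set 'I_n}) : U P *m V P *m A P = A P.
Proof. by have [] := svalP (cid (svalP (cid (int_mx_retract (A P))))). Qed.

(** If w respects the relations between the generators, it comes from a
    homomorphism on the lattice that they span, which is determined by its
    values mexp w (V P j) on a basis. *)
Lemma unit_param (P : {set 'I_n}) (w : 'I_n -> fps K) :
    (forall i, w i \is a GRing.unit) ->
    (forall c : 'rV_n, c *m A P = 0 -> mexp w (c ord0) = 1) ->
  forall i, w i = \prod_j mexp w (V P j) ^ (U P i j).
Proof.
move=> uw h i; pose c : 'rV[int]_n := delta_mx ord0 i - row i (U P *m V P).
have cA : c *m A P = 0 by rewrite mulmxBl -rowE -row_mul UVA subrr.
have -> : \prod_j mexp w (V P j) ^ (U P i j) = mexp w ((U P *m V P) i).
  transitivity (\prod_j \prod_k (w k ^ V P j k) ^ U P i j).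
    by apply: eq_bigr => j _; apply: exprz_prod => k; apply: unitrXz.
  rewrite exchange_big /=; apply: eq_bigr => k _; rewrite mxE exprz_sum //.
  by apply: eq_bigr => j _; rewrite exprz_exp mulrC.
have <- : mexp w (c ord0) * mexp w ((U P *m V P) i) = w i.
  rewrite /mexp -big_split /= (bigD1 i) //= big1 ?mulr1 => [|k ki].
    by rewrite -exprzDr // !mxE !eqxx /= subrK expr1z.
  by rewrite -exprzDr // !mxE eqxx (negPf ki) /= subrK.
by rewrite h // mul1r.
Qed.

Let N := (n * s.+1)%N.

(** The entries of q are the coefficients of n power series truncated at order
    s + 1. *)
Let prm (q : 'rV[K]_N) (j : 'I_n) : fps K :=
  fun k => if (k <= s)%N then vec_mx q j (inord k) else 0.
Let pw (q : 'rV[K]_(N + N)) := prm (lsubmx q).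
Let pw' (q : 'rV[K]_(N + N)) := prm (rsubmx q).

Lemma polyfps_pw j : polyfps (pw^~ j).
Proof.
move=> k; rewrite /pw /prm; case: (k <= s)%N; last exact: (polyfn_const _ 0).
suff -> : (fun q : 'rV[K]_(N + N) => vec_mx (lsubmx q) j (inord k)) =
    (fun q => q ord0 (lshift N (mxvec_index j (inord k)))) by exact: polyfn_coord.
by apply/funext => q; rewrite !mxE.
Qed.

Lemma polyfps_pw' j : polyfps (pw'^~ j).
Proof.
move=> k; rewrite /pw' /prm; case: (k <= s)%N; last exact: (polyfn_const _ 0).
suff -> : (fun q : 'rV[K]_(N + N) => vec_mx (rsubmx q) j (inord k)) =
    (fun q => q ord0 (rshift N (mxvec_index j (inord k)))) by exact: polyfn_coord.
by apply/funext => q; rewrite !mxE.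
Qed.

Let mono_val (P : {set 'I_n}) (b : 'I_n -> nat) q (i : 'I_n) : fps K :=
  if i \in P then fpsX ^+ b i * \prod_j ipow (pw q j) (pw' q j) (U P i j) else 0.

Let unit_eq q (jk : 'I_n * 'I_s.+1) : K := (pw q jk.1 * pw' q jk.1) jk.2 - (1 : fps K) jk.2.

Let jet_piece (P : {set 'I_n}) (b : 'I_n -> nat) : set 'rV[K]_N :=
  [set x | exists q, (forall jk, unit_eq q jk = 0) /\
     forall l, x ord0 l = jet_row s (mono_val P b q) ord0 l].

(** Every coefficient is a polynomial in the parameters. *)
Lemma jet_piece_constructible P b : constructible (jet_piece P b).
Proof.
apply: (constructible_image (Q := fun jk q => unit_eq q jk)
  (F := fun l q => jet_row s (mono_val P b q) ord0 l)) => [jk|l].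
  apply: polyfnD; last exact: polyfn_const.
  by apply: polyfpsM; [exact: polyfps_pw|exact: polyfps_pw'].
case/mxvec_indexP: l => i k; under eq_fun do rewrite mxvecE mxE.
rewrite /mono_val; case: (i \in P); last exact: (polyfps_const _ 0).
apply: (@polyfpsM _ _ (fun=> fpsX ^+ b i)
  (fun q => \prod_j ipow (pw q j) (pw' q j) (U P i j)) (polyfps_const _ _)).
apply: polyfps_prod => j; case: (U P i j) => z /=.
  exact/polyfpsX/polyfps_pw.
exact/polyfpsX/polyfps_pw'.
Qed.


(** For a the orders of the values on the generators of a character with
    support the face spanned by P. *)
Let realizable (P : {set 'I_n}) (b : 'I_n -> nat) : Prop :=
  exists a : 'I_n -> nat,
   [/\ forall c : 'rV_n, c *m A P = 0 -> \sum_i c ord0 i * (a i)%:Z = 0,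
       forall i, i \in P -> (0 < a i)%N /\ b i = minn (a i) s.+1,
       is_sface S (nspan g (mem P)) & forall i, nspan g (mem P) (g i) -> i \in P].

(** Powers of t beyond s + 1 do not matter modulo t ^ (s + 1), so finitely
    many exponents b suffice. *)
Lemma fps_cong_min a (f : fps K) : fps_cong s (fpsX ^+ a * f) (fpsX ^+ minn a s.+1 * f).
Proof.
move=> k ks; rewrite !fpsXnM; case: (leqP a s) => [as_|sa].
  by rewrite (minn_idPl _) // leqW.
by rewrite (minn_idPr sa) ltnS ks (leq_ltn_trans ks).
Qed.

Lemma fps_cong_trans (f h k : fps K) : fps_cong s f h -> fps_cong s h k -> fps_cong s f k.
Proof. by move=> fh hk i i_s; rewrite fh // hk. Qed.

Lemma fps_cong_sym (f h : fps K) : fps_cong s f h -> fps_cong s h f.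
Proof. by move=> fh i i_s; rewrite fh. Qed.

Lemma fps_cong_ipow (w w1 w1' : fps K) z : fps_cong s w w1 -> fps_cong s w^-1 w1' ->
  fps_cong s (w ^ z) (ipow w1 w1' z).
Proof. by move=> ww ww'; rewrite -ipowE; case: z => k /=; exact: fps_congX. Qed.

Lemma jet_row_cong (x y : 'I_n -> fps K) : (forall i, fps_cong s (x i) (y i)) ->
  jet_row s x = jet_row s y.
Proof.
by move=> xy; congr mxvec; apply/matrixP => i k; rewrite !mxE xy // -ltnS.
Qed.

(** P is the set of generators on which chi does not vanish, a i and w i the
    order and unit part of chi (g i), and the parameters are the truncations
    of the values of w on a basis. *)
Lemma jet_set_piece (x : 'rV[K]_N) : @jet_set K M S n g s x ->
  exists (P : {set 'I_n}) (b : {ffun 'I_n -> 'I_s.+2}),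
    realizable P (fun i => b i) /\ jet_piece P (fun i => b i) x.
Proof.
move=> [chi chiS ->]; have [chi0 chiD chi1] := chiS.
have S0 : S 0 by exact: nspan0.
have SD : forall u v, S u -> S v -> S (u + v) by exact: nspanD.
have Sg i : S (g i) by exact: nspan_gen.
pose P := [set i | chi (g i) != 0]%SET.
have /(_ _)/cid-/all_sig[a /(_ _)/cid-/all_sig[w haw]] : forall i, exists a w,
    w \is a GRing.unit /\ if i \in P then chi (g i) = fpsX ^+ a * w else a = 0%N /\ w = 1.
  move=> i; rewrite inE; have [c0|/fps_order[a [w [uw e0]]]] /= := eqVneq (chi (g i)) 0.
    by exists 0%N, 1; rewrite unitr1.
  by exists a, w.
have uw i : w i \is a GRing.unit by have [] := haw i.
have chiP i : i \in P -> chi (g i) = fpsX ^+ a i * w i by move=> iP; have [_] := haw i;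
  rewrite iP.
have chiNP i : i \notin P -> a i = 0%N /\ w i = 1.
  by move=> /negPf iP; have [_] := haw i; rewrite iP.
have rel := character_relation chiS uw chiP chiNP.
pose b := [ffun i => inord (minn (a i) s.+1) : 'I_s.+2].
have bE i : b i = minn (a i) s.+1 :> nat by rewrite ffunE inordK // ltnS geq_minr.
have fT := character_sface S0 SD chiS.
have TE : [set u | S u /\ chi u != 0] = nspan g (mem P).
  rewrite (sface_span fT (erefl _)); congr (nspan g _); apply/funext => i /=.
  rewrite [RHS]inE; apply/asboolP/idP => [[]//|]; by split.
exists P, b; split.
  exists a; split=> [c /rel[]//|i iP||i]; last 2 first.
  - by rewrite -TE.
  - by rewrite -TE inE => -[].
  split; last exact: bE.
  rewrite lt0n; apply/negP => /eqP ai; have := chi1 _ (Sg i) (@g_neq0 i).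
  by rewrite chiP // ai expr0 mul1r => /eqP; apply/negP; have := uw i; rewrite fps_unitE.
pose W j := mexp w (V P j).
have uW j : W j \is a GRing.unit by exact: mexp_unit.
pose tr (F : 'I_n -> fps K) : 'rV[K]_N := mxvec (\matrix_(j < n, k < s.+1) F j k).
have prm_cong (F : 'I_n -> fps K) j : fps_cong s (F j) (prm (tr F) j).
  by move=> k ks; rewrite /prm ks /tr mxvecK mxE inordK.
pose q := row_mx (tr W) (tr (fun j => (W j)^-1)).
have pwW j : fps_cong s (W j) (pw q j) by rewrite /pw row_mxKl.
have pwW' j : fps_cong s (W j)^-1 (pw' q j) by rewrite /pw' row_mxKr;
  exact: (prm_cong (fun j => (W j)^-1)).
exists q; split=> [[j k]|l].
  apply/eqP; rewrite subr_eq0 /=; apply/eqP.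
  rewrite -(fps_congM (pwW j) (pwW' j)) ?divrr //; exact: ltn_ord k.
apply: (congr1 (fun y : 'rV[K]_N => y ord0 l)); apply: jet_row_cong => i; rewrite /mono_val /=.
case: ifP => [iP|/negbT]; last by rewrite inE negbK => /eqP->.
rewrite chiP // bE; apply: fps_cong_trans (@fps_cong_min _ _) _; apply: fps_congM => //.
rewrite (unit_param uw (fun c cA => (rel c cA).2) i).
by apply: fps_cong_prod => j; apply: fps_cong_ipow; [exact: pwW|exact: pwW'].
Qed.

(** Conversely, the truncated parameters are units of the ring of power
    series, and any choice of such units defines a character of the face
    spanned by P, which extends by 0: here the freeness of the lattice spanned
    by P is used. *)
Lemma piece_jet_set (x : 'rV[K]_N) P b : realizable P b -> jet_piece P b x ->
  @jet_set K M S n g s x.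
Proof.
move=> [a [ra hab fT Pgen]] [q [hq hx]].
have {hq} hq j : fps_cong s (pw q j * pw' q j) 1.
  move=> k ks; apply/eqP; rewrite -subr_eq0; apply/eqP.
  by have := hq (j, Ordinal (ks : (k < s.+1)%N)).
pose W := pw q; have uW j : W j \is a GRing.unit.
  rewrite fps_unitE; apply/eqP => W0; have := hq j 0%N (leq0n _).
  by rewrite fpsM0 -/(W j) W0 mul0r fps1E => /eqP; rewrite eq_sym oner_eq0.
have W'E j : fps_cong s (W j)^-1 (pw' q j).
  apply: fps_cong_sym; rewrite -[X in fps_cong s X](mulKr (uW j)) -[X in fps_cong s _ X]mulr1.
  by apply: fps_congM.
(* the value of the character at the combination of the generators in P with
   coefficients c; it only depends on this combination *)
pose vl (c : 'I_n -> nat) : fps K := fpsX ^+ (\sum_i a i * c i) *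
  \prod_j W j ^ ((\row_i (c i)%:Z) *m U P) ord0 j.
have vlE c c' : \sum_(i in P) g i *+ c i = \sum_(i in P) g i *+ c' i -> vl c = vl c'.
  move=> /relation_mx rc; have := ra _ rc; have := UP rc.
  have -> : \row_i ((c i)%:Z - (c' i)%:Z) = \row_i (c i)%:Z - \row_i (c' i)%:Z.
    by apply/rowP => i; rewrite !mxE.
  rewrite mulmxBl => /eqP; rewrite subr_eq0 => /eqP cU ac; rewrite /vl cU.
  congr (_ ^+ _ * _); apply/eqP; rewrite -eqz_nat !(big_morph Posz PoszD (erefl (Posz 0))).
  rewrite -subr_eq0 -sumrB -[X in _ == X]ac; apply/eqP; apply: eq_bigr => i _.
  by rewrite !mxE mulrBl !PoszM mulrC (mulrC _ (Posz (c' i))).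
have vlD c c' : vl (fun i => c i + c' i)%N = vl c * vl c'.
  rewrite /vl mulrACA -exprD -big_split /= -big_split /=; congr (_ ^+ _ * _).
    by apply: eq_bigr => i _; rewrite mulnDr.
  apply: eq_bigr => j _; rewrite -exprzDr //; congr (_ ^ _).
  transitivity ((\row_i (c i)%:Z *m U P + \row_i (c' i)%:Z *m U P) ord0 j); last by rewrite mxE.
  rewrite -mulmxDl; congr ((_ *m _) _ _); by apply/rowP => i; rewrite !mxE.
pose chi u : fps K := if pselect (nspan g (mem P) u) is left h then vl (sval (cid h)) else 0.
have chiE c : chi (\sum_(i in P) g i *+ c i) = vl c.
  rewrite /chi; case: pselect => [h|[]]; last by exists c.
  by apply: vlE; rewrite -(svalP (cid h)).
have chiT : character (nspan g (mem P)) chi.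
  split.
  - have -> : 0 = \sum_(i in P) g i *+ 0 by rewrite big1.
    rewrite chiE /vl big1 => [|i _]; last by rewrite muln0.
    rewrite mul1r big1 // => j _.
    by rewrite (_ : \row_i _ = 0) ?mul0mx ?mxE //; apply/rowP => i; rewrite !mxE.
  - move=> u v [c ->] [c' ->]; rewrite -big_split /=.
    by under eq_bigr do rewrite -mulrnDr; rewrite !chiE vlD.
  - move=> u [c ->] u0; rewrite chiE /vl fpsXnM.
    have [//|] := ltnP; rewrite leqn0 sum_nat_eq0 => /forallP h; case: u0.
    apply: big1 => i iP; have := h i; rewrite muln_eq0 => /orP[/eqP ai|/eqP->].
      by have [] := hab i iP; rewrite ai.
    by rewrite mulr0n.
exists (fun u => if `[< nspan g (mem P) u >] then chi u else 0); first exact: character_ext.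
apply/rowP => l; rewrite hx; apply: (congr1 (fun y : 'rV[K]_N => y ord0 l)).
apply: jet_row_cong => i; rewrite /mono_val /=.
case: ifP => [iP|/negbT iP]; last first.
  by rewrite asboolF // => /Pgen; apply/negP.
rewrite asboolT; last exact: nspan_gen.
have -> : chi (g i) = fpsX ^+ a i * \prod_j W j ^ (U P i j).
  have {1}-> : g i = \sum_(j in P) g j *+ (j == i).
    rewrite (bigD1 i) //= eqxx mulr1n big1 ?addr0 // => j /andP[_ /negPf->].
    by rewrite mulr0n.
  rewrite chiE /vl (bigD1 i) //= eqxx muln1 big1 ?addn0 => [|j /negPf->]; last by rewrite muln0.
  congr (_ * _); apply: eq_bigr => j _; congr (_ ^ _).
  rewrite mxE (bigD1 i) //= big1 ?addr0 => [|k /negPf ki]; first by rewrite mxE eqxx mul1r.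
  by rewrite mxE ki mul0r.
apply: fps_cong_sym; have [_ ->] := hab i iP.
apply: fps_cong_trans (@fps_cong_min _ _) _; apply: fps_congM => //.
by apply: fps_cong_prod => j; apply: fps_cong_ipow; [|exact: W'E].
Qed.

Lemma jet_set_constructible : constructible (@jet_set K M S n g s).
Proof.
pose F (Pb : {set 'I_n} * {ffun 'I_n -> 'I_s.+2}) : set 'rV[K]_N :=
  if `[< realizable Pb.1 (fun i => Pb.2 i) >] then jet_piece Pb.1 (fun i => Pb.2 i) else set0.
have -> : @jet_set K M S n g s = [set x | exists Pb, F Pb x].
  apply/seteqP; split => x /=.
    by move=> /jet_set_piece[P [b [rPb Jx]]]; exists (P, b); rewrite /F /= asboolT.
  by move=> [[P b]]; rewrite /F /=; case: asboolP => // r /(piece_jet_set r).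
apply: constructible_finU => Pb; rewrite /F; case: asboolP => _.
  exact: jet_piece_constructible.
exact: constructible0.
Qed.

End ConstructibleJets.

(** * Faces of the dual cone *)

Section Farkas.
Variable M : zmodType.
Implicit Types (s : seq M) (u v x b : M) (y z : {additive M -> int}).

(** The non-negative integer combinations of s, by recursion on s to match the
    induction of [farkas]. *)
Fixpoint ncone s u : Prop :=
  if s is x :: s' then exists k, ncone s' (u - x *+ k) else u = 0.

Lemma ncone_sub (T : set M) s : T 0 -> (forall u v, T u -> T v -> T (u + v)) ->
  (forall x, x \in s -> T x) -> ncone s `<=` T.
Proof.
move=> T0 TD; elim: s => [_ u ->//|x s IH Ts u [k uk]].
rewrite -(subrK (x *+ k) u); apply: (TD).
  by apply: IH => // v vs; apply: Ts; rewrite inE vs orbT.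
by elim: k {uk} => [|k IHk]; rewrite ?mulr0n // mulrS; apply: (TD) => //; apply: Ts;
  apply: mem_head.
Qed.

(** The elements a + (y a / p) x are combinations of a and x when y a and p
    are non-negative; multiplication by p clears the denominator. *)
Lemma ncone_proj s x (p : nat) y u : (forall a, a \in s -> 0 <= y a) ->
    ncone [seq x *~ y a + a *+ p | a <- s] u ->
  exists k, ncone s (u - x *+ k).
Proof.
elim: s u => [u _ -> |a s IH u ys [m um]]; first by exists 0%N; rewrite /= mulr0n subr0.
have ya : 0 <= y a by apply: ys; rewrite mem_head.
have [k uk] : exists k, ncone s (u - (x *~ y a + a *+ p) *+ m - x *+ k).
  by apply: IH um => b bs; apply: ys; rewrite inE bs orbT.
exists (k + `|y a| * m)%N, (p * m)%N; congr (ncone s _): uk.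
rewrite -[in LHS](gez0_abs ya) -pmulrn mulrnDl -!mulrnA mulrnDr !opprD !addrA.
by rewrite [LHS]addrAC; congr (_ - _); rewrite addrAC.
Qed.

(** Farkas' lemma over the integers, by induction on the number of generators.
    Let x be the first one, and y a form, provided by the induction
    hypothesis, that separates b from the other ones. If y x < 0, project
    along x onto the kernel of y and apply the induction hypothesis again: the
    alternatives for the projected vectors lift to the ones for the original
    vectors. The projection is scaled by - y x so that it has integer
    coefficients. *)
Lemma farkas (sep : forall u, u <> 0 -> exists y, y u <> 0) s b :
  (exists2 N, (0 < N)%N & ncone s (b *+ N)) \/
  exists2 y : {additive M -> int}, (forall a, a \in s -> 0 <= y a) & y b < 0.
Proof.
move: {2}(size s) (erefl (size s)) => n; elim: n s b => [|n IH] [//|x s] b //=.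
  move=> _; have [->|/eqP/sep[y yb]] := eqVneq b 0; first by left; exists 1%N.
  right; case: (ltrgtP (y b) 0) => [yb0|yb0|//]; first by exists y.
  by exists (-%R \o y) => //=; rewrite oppr_lt0.
move=> [sn]; have [[N N0 bN]|[y ys yb]] := IH s b sn.
  by left; exists N => //; exists 0%N; rewrite mulr0n subr0.
have [yx|yx] := leP 0 (y x).
  by right; exists y => // a; rewrite inE => /orP[/eqP->//|/ys].
pose p := `|y x|%N; have px : y x = - p%:Z by rewrite /p ltz0_abs // opprK.
have [[N N0 bN]|[z zs zb]] := IH [seq x *~ y a + a *+ p | a <- s] (x *~ y b + b *+ p)
    (etrans (size_map _ _) sn).
  left; have [k bk] := ncone_proj ys bN; exists (p * N)%N.
    by rewrite muln_gt0 N0 andbT /p absz_gt0 lt_eqF.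
  exists (k + `|y b| * N)%N; congr (ncone s _): bk.
  have -> : y b = - `|y b|%N%:Z by rewrite ltz0_abs // opprK.
  rewrite mulrNz -pmulrn mulrnDl mulNrn -!mulrnA abszN absz_nat mulrnDr opprD addrA.
  by rewrite [- _ + _]addrC addrAC.
right; exists ((z x \*o y) \+ (p%:Z \*o z)) => [a|] /=.
  rewrite inE => /orP[/eqP->|as_].
    by rewrite px mulrN [z x * _]mulrC addNr.
  have := zs _ (map_f _ as_).
  by rewrite raddfD raddfMz raddfMn -mulrzr intz -mulr_natl natz mulrC.
by move: zb; rewrite raddfD raddfMz raddfMn -mulrzr intz -mulr_natl natz mulrC.
Qed.

End Farkas.

Section Faces.
Variables (R : realType) (M : zmodType) (L : addrClosed M).
Variables (n : nat) (g : 'I_n -> M).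
Hypothesis gL : nspan g predT = [set u | u \in L].

Lemma MR_sumE k (c : 'I_k -> R) (u : 'I_k -> M) (nu : NR R M) :
  (\sum_i c i *: (inMR (u i) : MR R M)) nu = \sum_i c i * nu (u i).
Proof. by rewrite (@big_morph R (MR R M) (fun w => w nu) 0 +%R 0 +%R). Qed.

Lemma dual_coneP (nu : NR R M) : dual_cone (cone_of R L) nu <-> forall u, u \in L -> 0 <= nu u.
Proof.
split=> [h u uL|h w [k [c [u [cu ->]]]]].
  rewrite -[nu u]/((inMR u : MR R M) nu); apply: h; exists 1%N, (fun=> 1), (fun=> u).
  by split=> [i|]; [split|rewrite big_ord1 scale1r].
rewrite MR_sumE; apply: sumr_ge0 => i _; have [c0 uL] := cu i.
by rewrite mulr_ge0 // h.
Qed.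

Lemma is_faceP (theta : set (NR R M)) : is_face (cone_of R L) theta <->
  exists k (c : 'I_k -> R) (u : 'I_k -> M), (forall i, 0 <= c i /\ u i \in L) /\
    theta = [set nu | dual_cone (cone_of R L) nu /\ \sum_i c i * nu (u i) = 0].
Proof.
split=> [[w [k [c [u [cu ->]]]] ->]|[k [c [u [cu ->]]]]].
  by exists k, c, u; split => //; apply/seteqP; split => nu /=; rewrite MR_sumE.
exists (\sum_i c i *: (inMR (u i) : MR R M)); first by exists k, c, u.
by apply/seteqP; split => nu /=; rewrite MR_sumE.
Qed.

Lemma face_dual theta nu : is_face (cone_of R L) theta -> theta nu ->
  forall u, u \in L -> 0 <= nu u.
Proof. by move=> [w _ ->] [/dual_coneP]. Qed.

Lemma perpP theta u :
  reflect (u \in L /\ forall nu : NR R M, theta nu -> nu u = 0) (u \in perp L theta).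
Proof. by rewrite unfold_in; apply: (iffP andP) => -[uL /asboolP]. Qed.

(** The forms in theta are non-negative on L, so they vanish on u and v as
    soon as they vanish on u + v. *)
Lemma perp_sface theta : is_face (cone_of R L) theta ->
  is_sface [set u | u \in L] [set u | u \in perp L theta].
Proof.
move=> ft; split=> [u /perpP[]//||u v|u v uL vL /perpP[_ uv]]; first exact: rpred0.
  exact: rpredD.
apply/perpP; split => // nu tnu; apply/eqP; rewrite eq_le (face_dual ft tnu uL) andbT.
by rewrite -(uv nu tnu) raddfD lerDl (face_dual ft tnu vL).
Qed.

(** If theta is cut out by w, then the elements of L that occur in w with a
    nonzero coefficient are in perp L theta. *)
Lemma face_perpE theta : is_face (cone_of R L) theta ->
  theta = [set nu | dual_cone (cone_of R L) nu /\ forall u, u \in perp L theta -> nu u = 0].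
Proof.
move=> ft; have [k [c [u [cu tE]]]] := (is_faceP theta).1 ft.
apply/seteqP; split => nu.
  by move=> tnu; split => [|v /perpP[_]]; [move: tnu; rewrite tE => -[]|apply].
move=> [dnu pnu]; rewrite tE; split => //; apply: big1 => i _.
have [c0 uL] := cu i; have [->|ci] := eqVneq (c i) 0; first by rewrite mul0r.
rewrite pnu ?mulr0 //; apply/perpP; split => // mu; rewrite tE => -[/dual_coneP dmu].
move/eqP; rewrite psumr_eq0 => [|j _]; last by have [? ?] := cu j; rewrite mulr_ge0 ?dmu.
by move/allP/(_ i (mem_index_enum i)); rewrite /= mulf_eq0 (negPf ci) => /eqP.
Qed.

Lemma face_perp_inj theta theta' :
    is_face (cone_of R L) theta -> is_face (cone_of R L) theta' ->
    (forall u, u \in perp L theta = (u \in perp L theta')) ->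
  theta = theta'.
Proof.
move=> ft ft' e; rewrite (face_perpE ft) (face_perpE ft').
by apply/seteqP; split => nu [dnu h]; split => // u up; apply: h; rewrite ?e // -e.
Qed.

(** A face is determined by the generators of L that lie in perp L theta. *)
Lemma finite_faces : finite_set [set theta | is_face (cone_of R L) theta].
Proof.
pose F (J : {set 'I_n}) : set (NR R M) :=
  [set nu | dual_cone (cone_of R L) nu /\ forall i, i \in J -> nu (g i) = 0].
apply: (@sub_finite_set _ _ (F @` setT)); last exact/finite_image/finite_finset.
move=> theta ft; exists [set i | g i \in perp L theta]%SET => //.
rewrite [RHS](face_perpE ft); apply/seteqP; split => nu [dnu h]; split => //.
  move=> u up; have : [set u | u \in perp L theta] u by [].
  rewrite (sface_span (perp_sface ft) gL) => -[c ->]; rewrite raddf_sum big1 // => i;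
    rewrite unfold_in => /asboolP ip.
  by rewrite raddfMn h ?mul0rn // inE.
by move=> i; rewrite inE; apply: h.
Qed.

Lemma sface_mem_Mn (T : set M) u k : is_sface [set u | u \in L] T -> u \in L -> (0 < k)%N ->
  T (u *+ k) -> T u.
Proof.
move=> [_ _ _ Tdiv] uL; case: k => // k _; rewrite mulrS; apply: Tdiv => //=.
exact: rpredMn.
Qed.

(** Every face T of the semigroup L is cut out by a face of the dual cone,
    defined by the sum w of the generators in T. If an element u of L outside
    T vanished on all the forms of that face, then no form would be
    non-negative on the generators and on - w, and negative on - u; Farkas'
    lemma then makes a multiple of u a summand of a multiple of w. *)
Lemma sface_perp (sep : forall u : M, u <> 0 -> exists y : {additive M -> int}, y u <> 0)
    (T : set M) : is_sface [set u | u \in L] T ->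
  exists2 theta, is_face (cone_of R L) theta & forall u, u \in perp L theta <-> T u.
Proof.
move=> fT; have [TL T0 TD Tdiv] := fT.
have Lg i : g i \in L by rewrite -[is_true _]/([set u | u \in L] (g i)) -gL; apply: nspan_gen.
(* the form w is the sum of the generators in T *)
pose cc i : R := (`[< T (g i) >])%:R.
pose theta : set (NR R M) :=
  [set nu | dual_cone (cone_of R L) nu /\ \sum_i cc i * nu (g i) = 0].
have ft : is_face (cone_of R L) theta.
  by apply/is_faceP; exists n, cc, g; split => // i; split; rewrite ?ler0n.
exists theta => // u; split=> [/perpP[uL hu]|Tu]; last first.
  apply/perpP; split; first exact: TL.
  move: Tu; rewrite (sface_span fT gL) => -[c ->].
  move=> nu [/dual_coneP dnu] /eqP; rewrite psumr_eq0 => [/allP h|i _]; last first.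
    by rewrite mulr_ge0 ?ler0n // dnu.
  rewrite raddf_sum big1 // => i; rewrite unfold_in => Ti.
  have := h i (mem_index_enum i); rewrite /= /cc Ti mul1r => /eqP nui.
  by rewrite raddfMn nui mul0rn.
apply: contrapT => nTu.
pose w := \sum_(i | `[< T (g i) >]) g i.
have Tw : T w by apply: (big_ind T) => // i /asboolP.
have [[N N0 cN]|[y hy yu]] := farkas sep (- w :: [seq g i | i <- enum 'I_n]) (- u).
  case: cN => k; rewrite !mulNrn opprK => hk; apply: nTu.
  apply: (sface_mem_Mn fT uL N0).
  apply: (Tdiv _ (- (u *+ N) + w *+ k)) => //=; first exact: rpredMn.
    move: hk; apply: (ncone_sub (T := [set u | u \in L])) => /=.
    - exact: rpred0.
    - by move=> x z; apply: rpredD.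
    - by move=> x /mapP[i _ ->].
  rewrite addNKr; elim: (k) => [|m IH]; [by rewrite mulr0n|by rewrite mulrS; apply: TD].
pose nu : NR R M := (intr : {additive int -> R}) \o y.
have : nu u = 0.
  apply: hu; split.
    apply/dual_coneP => v vL; rewrite /nu /= ler0z.
    have : nspan g predT v by rewrite gL.
    move=> [c ->]; rewrite raddf_sum; apply: sumr_ge0 => i _; rewrite raddfMn mulrn_wge0 //.
    by apply: hy; rewrite inE map_f ?orbT // mem_enum.
  have hg i : 0 <= y (g i) by apply: hy; rewrite inE map_f ?orbT // mem_enum.
  have : 0 <= y (- w) by apply: hy; rewrite mem_head.
  rewrite raddfN oppr_ge0 raddf_sum => yw.
  have : \sum_(i | `[< T (g i) >]) y (g i) == 0.
    by rewrite eq_le yw sumr_ge0.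
  rewrite psumr_eq0 // => /allP h; apply: big1 => i _; rewrite /cc.
  have := h i (mem_index_enum i); case: asboolP => Ti /=; last by rewrite mul0r.
  by rewrite mul1r => /eqP->.
move/eqP; rewrite /nu /= intr_eq0 => /eqP yu0; move: yu.
by rewrite raddfN yu0 oppr0 ltxx.
Qed.

End Faces.

(** * Minimal generators *)

Section MinGens.
Variables (M : zmodType).
Implicit Types (L : addrClosed M).

Definition sg_set L : set M := [set u | u \in L].

Definition pointed (S : set M) : Prop := forall u v, S u -> S v -> u + v = 0 -> u = 0.

Definition irreducible (S : set M) (u : M) : Prop :=
  [/\ S u, u <> 0 & forall v w, S v -> S w -> u = v + w -> v = 0 \/ w = 0].

(** Decompositions in S of an element of T stay in T. *)
Lemma irreducible_sface (S T : set M) u : is_sface S T ->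
  irreducible T u <-> irreducible S u /\ T u.
Proof.
move=> [TS T0 TD Tdiv]; split=> [[Tu u0 h]|[[Su u0 h] Tu]].
  split => //; split => [||v w Sv Sw e] //; first exact: TS.
  apply: h => //; first by apply: (Tdiv _ w) => //; rewrite -e.
  by apply: (Tdiv _ v) => //; rewrite addrC -e.
by split => // v w Tv Tw; apply: h; exact: TS.
Qed.

Section Generators.
Variable L : addrClosed M.
Implicit Types (G : seq (sg_elt L)) (u v w : sg_elt L).

Lemma sg_valD u v : sg_val (u + v) = sg_val u + sg_val v. Proof. by []. Qed.
Lemma sg_val0 : sg_val (0 : sg_elt L) = 0. Proof. by []. Qed.

Lemma sg_val_inj : injective (@sg_val M L). Proof. exact: val_inj. Qed.

(** Generation in the form of an induction principle. *)
Lemma generatesP G : generates G <-> forall T : set (sg_elt L),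
  T 0 -> (forall u v, T u -> T v -> T (u + v)) -> (forall u, u \in G -> T u) -> forall u, T u.
Proof.
split=> [hG T T0 TD TG u|h].
  have [c ->] := hG u; apply: (big_ind T) => // i _.
  have Ti : T G`_i by apply: TG; apply: mem_nth.
  by elim: (c i) => [|k IH]; rewrite ?mulr0n // mulrS; apply: TD.
apply: (h [set u | exists c : nat -> nat, u = \sum_(i < size G) G`_i *+ c i]).
- by exists (fun=> 0%N); rewrite big1.
- move=> u v [c ->] [d ->]; exists (fun i => c i + d i)%N.
  by rewrite -big_split; apply: eq_bigr => i _; rewrite mulrnDr.
- move=> u uG; have ui : (index u G < size G)%N by rewrite index_mem.
  exists (fun i => i == index u G)%N; rewrite (bigD1 (Ordinal ui)) //= eqxx mulr1n nth_index //.
  rewrite big1 ?addr0 // => i /negPf; rewrite -val_eqE /= => ->; exact: mulr0n.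
Qed.

Lemma generates_sub G G' : {subset G <= G'} -> generates G -> generates G'.
Proof.
move=> GG /generatesP hG; apply/generatesP => T T0 TD TG.
by apply: hG => // u /GG; apply: TG.
Qed.

(** A generating sequence of minimal length is minimal for inclusion. *)
Lemma min_gens_exists : fin_generated L -> is_min_gens (min_gens L).
Proof.
move=> [G0 gG0]; suff [G hG] : exists G, @is_min_gens M L G by rewrite /min_gens;
  case: xgetP => [_ _ //|/(_ G)].
pose Q k := `[< exists2 G, @generates M L G & size G = k >].
have exQ : exists k, Q k by exists (size G0); apply/asboolP; exists G0.
case: (ex_minnP exQ) => k /asboolP[G gG sG] kmin; exists G.
have lemin G' : generates G' -> (k <= size G')%N.
  by move=> gG'; apply: kmin; apply/asboolP; exists G'.
split => // [|G' GG' gG'].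
  apply/negPn; rewrite -ltn_size_undup -leqNgt sG; apply: lemin.
  by apply: generates_sub gG => u; rewrite mem_undup.
have gU : generates (undup G') by apply: generates_sub gG' => u; rewrite mem_undup.
have sub : {subset undup G' <= G} by move=> u; rewrite mem_undup; exact: GG'.
have szU : (size G <= size (undup G'))%N by rewrite sG; exact: lemin.
have [_ e] := uniq_min_size (undup_uniq G') sub szU.
by move=> u; rewrite -(mem_undup G') e.
Qed.

(** In a pointed semigroup the minimal generators are the irreducible
    elements; this makes the minimal generators of a face those of the
    semigroup that lie in the face. *)
Lemma min_gens_irreducible : pointed (sg_set L) -> fin_generated L ->
  forall u, u \in min_gens L <-> irreducible (sg_set L) (sg_val u).
Proof.
move=> pL fgL; have [uG gG minG] := min_gens_exists fgL.
set G := min_gens L in uG gG minG *.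
have pt u v : u + v = 0 -> u = 0.
  move=> /(congr1 (@sg_val M L)); rewrite sg_valD => uv.
  by apply: sg_val_inj; apply: (pL _ (sg_val v)) => //; exact: sg_valP.
move=> u; split=> [uinG|[_ u0 hu]].
  have nG' : ~ generates (rem u G).
    move=> /(minG _ (fun v => @mem_rem _ u G v)) /(_ _ uinG).
    by rewrite mem_rem_uniq // inE eqxx.
  split => [|u0|v w Lv Lw uvw]; first exact: sg_valP.
    apply: nG'; apply/generatesP => T T0 TD TG; apply: (generatesP G).1 => // v vG.
    have [->|vu] := eqVneq v u; first by rewrite (sg_val_inj (u0 : sg_val u = sg_val 0)).
    by apply: TG; rewrite mem_rem_uniq // inE vu.
  apply: contrapT => /not_orP[v0 w0]; apply: nG'; apply/generatesP => T T0 TD TG.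
  pose v' := SgElt Lv; pose w' := SgElt Lw.
  have uv' : u = v' + w' by apply: sg_val_inj.
  (* v' and w' cannot be of the form u + y, since L is pointed *)
  have key x : T x \/ exists y, x = u + y.
    move: x.
    apply: ((generatesP G).1 gG [set x | T x \/ exists y, x = u + y]) => [|x y|x xG] /=.
    - by left.
    - move=> [Tx|[x' ->]]; last by right; exists (x' + y); rewrite addrA.
      move=> [Ty|[y' ->]]; last by right; exists (x + y'); rewrite addrCA.
      by left; exact: TD.
    have [->|xu] := eqVneq x u; first by right; exists 0; rewrite addr0.
    by left; apply: TG; rewrite mem_rem_uniq // inE xu.
  have cancel x y : u = u + x + y -> x = 0 /\ y = 0.
    move=> /(congr1 (@sg_val M L)); rewrite !sg_valD -addrA -[LHS]addr0 => /addrI e.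
    have xy : x + y = 0 by apply: sg_val_inj; rewrite sg_valD -e.
    by split; [exact: pt xy|apply: (pt _ x); rewrite addrC].
  have Tv : T v'.
    have [//|[y vy]] := key v'; case: w0.
    by have [|_ /(congr1 (@sg_val M L))] := cancel y w'; rewrite -?vy.
  have Tw : T w'.
    have [//|[y wy]] := key w'; case: v0.
    by have [|_ /(congr1 (@sg_val M L))] := cancel y v'; rewrite -?wy // addrC.
  apply: ((generatesP G).1 gG T) => // x xG.
  have [->|xu] := eqVneq x u; first by rewrite uv'; exact: TD.
  by apply: TG; rewrite mem_rem_uniq // inE xu.
move: hu u0; move: u.
apply: ((generatesP G).1 gG [set u | (forall x y : M, sg_set L x -> sg_set L y ->
  sg_val u = x + y -> x = 0 \/ y = 0) -> sg_val u <> 0 ->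
    u \in G]) => /= [_ []//|u v hu hv h n0|//].
have [/(@sg_val_inj u 0) u0|/(@sg_val_inj v 0) v0] := h _ _ (sg_valP u) (sg_valP v) erefl.
  by move: h n0; rewrite u0 ?sg_val0 !add0r; exact: hv.
by move: h n0; rewrite v0 ?sg_val0 !addr0; exact: hu.
Qed.

Definition min_gen (i : 'I_(size (min_gens L))) : M := sg_val (min_gens L)`_i.

Lemma min_gen_span : fin_generated L -> nspan min_gen predT = sg_set L.
Proof.
move=> fgL; have [_ gG _] := min_gens_exists fgL; apply/seteqP; split.
  apply: nspan_sub => [|u v uL vL|i _]; [exact: rpred0|exact: rpredD|exact: sg_valP].
move=> u uL; apply/nspanT; have [c /(congr1 (@sg_val M L)) /= e] := gG (SgElt uL).
exists (fun i => c i); rewrite [LHS]e (@big_morph _ _ (@sg_val M L) 0 +%R 0 +%R) //.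
apply: eq_bigr => i _; rewrite /min_gen.
by elim: (c i) => [|k IH]; rewrite ?mulr0n // !mulrS sg_valD IH.
Qed.

Lemma min_gen_inj : fin_generated L -> injective min_gen.
Proof.
move=> fgL i j /sg_val_inj /eqP; have [uG _ _] := min_gens_exists fgL.
by rewrite nth_uniq // => /eqP/val_inj.
Qed.

Lemma min_genP : pointed (sg_set L) -> fin_generated L ->
  forall x, (exists i, min_gen i = x) <-> irreducible (sg_set L) x.
Proof.
move=> pL fgL x; split=> [[i <-]|irrx].
  by apply/min_gens_irreducible => //; exact: mem_nth.
have [xL _ _] := irrx; have /(min_gens_irreducible pL fgL (SgElt xL)) xG := irrx.
have xi : (index (SgElt xL) (min_gens L) < size (min_gens L))%N by rewrite index_mem.
by exists (Ordinal xi); rewrite /min_gen nth_index.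
Qed.

End Generators.
End MinGens.

(** * The face spanned by a jet *)

Section FaceOfJet.
Variables (K : closedFieldType) (M : zmodType).
Implicit Types (S T : set M).

Definition jsupp n s (x : 'rV[K]_(n * s.+1)) : {pred 'I_n} :=
  fun i => [exists k, vec_mx x i k != 0].

Lemma jsuppPn n s (x : 'rV[K]_(n * s.+1)) i : i \notin jsupp x -> forall k, vec_mx x i k = 0.
Proof. by rewrite unfold_in negb_exists => /forallP h k; apply/eqP/negPn; exact: h. Qed.

(** The smallest face of S that contains the g i for i in P. *)
Definition face_hull S n (g : 'I_n -> M) (P : {pred 'I_n}) : set M :=
  [set u | S u /\ exists2 v, S v & nspan g P (u + v)].

Lemma face_hull_sface S n (g : 'I_n -> M) P : S 0 ->
  (forall u v, S u -> S v -> S (u + v)) -> is_sface S (face_hull S g P).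
Proof.
move=> S0 SD; split=> [u []//||u u' [Su [v Sv uv]] [Su' [v' Sv' uv']]|u u' Su Su' [_ [v Sv
  uv]]].
- by split => //; exists 0; rewrite // addr0; exact: nspan0.
- split; first exact: SD.
  by exists (v + v'); [exact: SD|rewrite addrACA; exact: nspanD].
- by split => //; exists (u' + v); [exact: SD|rewrite addrA].
Qed.

Lemma face_hull_min S T n (g : 'I_n -> M) P : is_sface S T ->
  (forall i, i \in P -> T (g i)) -> face_hull S g P `<=` T.
Proof.
move=> [TS T0 TD Tdiv] Tg u [Su [v Sv uv]]; apply: (Tdiv _ v) => //.
exact: nspan_sub uv.
Qed.

Lemma face_hull_gen S n (g : 'I_n -> M) (P : {pred 'I_n}) i : S 0 -> S (g i) -> i \in P ->
  face_hull S g P (g i).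
Proof.
by move=> S0 Sg iP; split => //; exists 0; rewrite // addr0; exact: nspan_gen.
Qed.

(** The jets with nonzero coordinates in the face T and in no smaller one. *)
Definition face_jets S n (g : 'I_n -> M) s T : set 'rV[K]_(n * s.+1) :=
  [set x | jet_set S g s x /\ face_hull S g (jsupp x) = T].

Local Arguments face_jets S {n} g s T _.

(** The face spanned by a jet only depends on which coordinates vanish, so
    finitely many locally closed conditions are involved. *)
Lemma face_jets_constructible S n (g : 'I_n -> M) s T :
  constructible (@jet_set K M S n g s) -> constructible (face_jets S g s T).
Proof.
move=> cJ; pose F : set 'rV[K]_(n * s.+1) := [set x | face_hull S g (jsupp x) = T].
rewrite (_ : face_jets S g s T = jet_set S g s `&` F) //; apply: constructibleI => //.
pose coord i k : set 'rV[K]_(n * s.+1) := [set x | vec_mx x i k = 0].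
have ccoord i k : constructible (coord i k).
  apply: zclosed_constructible; exists [set 'X_(mxvec_index i k)].
  apply/seteqP; split => x; rewrite /coord /= mxE.
    by move=> x0 _ ->; rewrite mevalXU.
  by move=> /(_ _ erefl); rewrite mevalXU.
pose Zset i : set 'rV[K]_(n * s.+1) := ~` [set x | exists k, (~` coord i k) x].
have cZ i : constructible (Zset i).
  by apply: constructibleC; apply: constructible_finU => k; apply: constructibleC.
have ZP i x : Zset i x <-> i \notin jsupp x.
  rewrite unfold_in negb_exists; split=> [h|/forallP h [k]].
    apply/forallP => k; rewrite negbK; apply/eqP; apply: contrapT => xk.
    by apply: h; exists k.
  by move=> nk; apply: nk; have := h k; rewrite negbK => /eqP.
pose pat (Z : {set 'I_n}) : set 'rV[K]_(n * s.+1) :=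
  \big[setI/setT]_(i <- enum 'I_n) (if i \in Z then ~` Zset i else Zset i).
have patP (Z : {set 'I_n}) x : pat Z x <-> jsupp x = (fun i => i \in Z) :> {pred 'I_n}.
  rewrite /pat -bigcap_seq; split=> [h|e i _ /=].
    apply/funext => i; have hi : i \in enum 'I_n by rewrite mem_enum.
    have := h i hi; suff : (if i \in Z then ~` Zset i else Zset i) x ->
      (i \in jsupp x) = (i \in Z) by [].
    case: (i \in Z) => [nZ|/ZP/negbTE//].
    by apply: contrapT => /negP/ZP; apply: nZ.
  have := ZP i x; rewrite e -[i \in fun _ => _]/(i \in Z); case: (i \in Z) => // -[h1 h2].
    by move=> /h1.
  exact: h2.
have -> : F =
    [set x | exists Z : {set 'I_n}, (if `[< face_hull S g (fun i => i \in Z) = T >] then pat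
      Z else set0) x].
  apply/seteqP; split => x; rewrite /F /=.
    move=> xT; exists [set i in jsupp x]%SET.
    have e : (fun i => i \in [set j in jsupp x]%SET) = jsupp x :> {pred 'I_n}.
      by apply/funext => i; rewrite inE.
    by rewrite e asboolT //; apply/patP; rewrite e.
  by move=> [Z]; case: asboolP => // e /patP ->.
apply: constructible_finU => Z; case: asboolP => _; last exact: constructible0.
by apply: constructible_bigI => i; case: ifP => _ //; exact: constructibleC.
Qed.

End FaceOfJet.

Arguments face_jets {K M} S {n} g s T _.

Section Transfer.
Variables (K : closedFieldType) (M : zmodType) (s : nat).

Section Face.
Variables (S T : set M) (n n' : nat) (g : 'I_n -> M) (g' : 'I_n' -> M) (f : 'I_n' -> 'I_n).
Hypotheses (gS : nspan g predT = S) (g'T : nspan g' predT = T) (fT : is_sface S T).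
Hypotheses (f_inj : injective f) (gf : forall i', g (f i') = g' i').
Hypothesis (f_surj : forall i, T (g i) -> exists i', f i' = i).

Definition jet_ext (x : 'rV[K]_(n' * s.+1)) : 'rV[K]_(n * s.+1) :=
  mxvec (\matrix_(i, k) if [pick i' | f i' == i] is Some i' then vec_mx x i' k else 0).

Definition jet_res (x : 'rV[K]_(n * s.+1)) : 'rV[K]_(n' * s.+1) :=
  mxvec (\matrix_(i', k) vec_mx x (f i') k).

Lemma pick_f i' : [pick j' | f j' == f i'] = Some i'.
Proof. by case: pickP => [j' /eqP/f_inj->|/(_ i')] //; rewrite eqxx. Qed.

Lemma jet_extE x i' k : vec_mx (jet_ext x) (f i') k = vec_mx x i' k.
Proof. by rewrite mxvecK mxE pick_f. Qed.

Lemma jet_ext0 x i k : (forall i', f i' <> i) -> vec_mx (jet_ext x) i k = 0.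
Proof. by move=> h; rewrite mxvecK mxE; case: pickP => [i' /eqP/h|]. Qed.

Lemma jet_extK : cancel jet_ext jet_res.
Proof.
move=> x; apply: (can_inj vec_mxK); apply/matrixP => i' k.
by rewrite mxvecK mxE jet_extE.
Qed.

Lemma jet_ext_poly : polymap jet_ext.
Proof.
move=> l; case/mxvec_indexP: l => i k.
case e : [pick i' | f i' == i] => [i'|].
  by exists 'X_(mxvec_index i' k) => x; rewrite mevalXU mxvecE mxE e mxE.
by exists 0 => x; rewrite meval0 mxvecE mxE e.
Qed.

Lemma jet_res_poly : polymap jet_res.
Proof.
move=> l; case/mxvec_indexP: l => i' k.
by exists 'X_(mxvec_index (f i') k) => x; rewrite mevalXU mxvecE mxE mxE.
Qed.

(** From right to left, a character of S restricts to T: a jet x that spans T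
    has null coordinates outside T, so x is the extension of the jet of the
    restriction. *)
Lemma face_jets_ext : jet_ext @` face_jets T g' s T = face_jets S g s T.
Proof.
have [TS T0 TD Tdiv] := fT.
have Sg i : S (g i) by rewrite -gS; apply: nspan_gen.
have Tg' i' : T (g' i') by rewrite -g'T; apply: nspan_gen.
have S0 : S 0 by exact: TS.
have SD u v : S u -> S v -> S (u + v) by rewrite -gS; exact: nspanD.
have extE x : jsupp (jet_ext x) =i [pred i | [exists i', (f i' == i) && (i' \in jsupp x)]].
  move=> i; rewrite !inE; apply/existsP/existsP => [[k]|[i' /andP[/eqP<- /existsP[k xk]]]].
    have [[i' <-]|nf] := pselect (exists i', f i' = i); last first.
      by rewrite jet_ext0 ?eqxx // => i' e; apply: nf; exists i'.
    by rewrite jet_extE => xk; exists i'; rewrite eqxx /=; apply/existsP; exists k.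
  by exists k; rewrite jet_extE.
apply/seteqP; split => [_ [_ [[chi chiT ->] e] <-]|x [[chi chiS xE] e]].
  set x := jet_row s _ in e *; split.
    exists (fun u => if `[< T u >] then chi u else 0); first exact: character_ext.
    apply: (can_inj vec_mxK); apply/matrixP => i k; rewrite vec_jet_row /=.
    case: asboolP => [/f_surj[i' <-]|nT]; first by rewrite jet_extE vec_jet_row /= gf.
    by rewrite jet_ext0 // => i' fi; apply: nT; rewrite -fi gf.
  apply/seteqP; split.
    apply: face_hull_min => // i; rewrite extE => /existsP[i' /andP[/eqP <- _]].
    by rewrite gf.
  move=> u Tu; split; first exact: TS.
  have : face_hull T g' (jsupp x) u by rewrite e.
  move=> [_ [v Tv uv]]; exists v; first exact: TS.
  apply: (nspan_sub (T := nspan g (jsupp (jet_ext x)))) uv => [|a b|i' xi'].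
  - exact: nspan0.
  - exact: nspanD.
  by rewrite -gf; apply: nspan_gen; rewrite extE; apply/existsP; exists i'; rewrite eqxx.
have Tx i : i \in jsupp x -> T (g i) by move=> xi; rewrite -e; exact: face_hull_gen.
exists (jet_row s (chi \o g')); last first.
  apply: (can_inj vec_mxK); apply/matrixP => i k.
  have [[i' <-]|nf] := pselect (exists i', f i' = i).
    by rewrite jet_extE xE !vec_jet_row /= gf.
  rewrite jet_ext0 => [|i' fi]; last by apply: nf; exists i'.
  apply/esym/jsuppPn/negP => /Tx/f_surj; exact: nf.
split; first by exists chi => //; exact: character_res TS _.
apply/seteqP; split => [u []//|u Tu]; split => //.
have : face_hull S g (jsupp x) u by rewrite e.
move=> [_ [v Sv uv]].
have Tuv : T (u + v) by apply: (nspan_sub T0 TD Tx).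
have Tv : T v by apply: (Tdiv _ u) => //; [exact: TS|rewrite addrC].
exists v => //; apply: (nspan_sub (T := nspan g' _)) uv => [|a b|i xi].
- exact: nspan0.
- exact: nspanD.
have /f_surj[i' fi] := Tx _ xi; rewrite -fi gf; apply: nspan_gen.
move: xi; rewrite -fi !unfold_in => /existsP[k xk]; apply/existsP; exists k.
by move: xk; rewrite xE !vec_jet_row /= gf.
Qed.

Lemma K0_class_face_jets_ext : constructible (@jet_set K M S n g s) ->
  K0_class (@face_jets K M T n' g' s T) = K0_class (@face_jets K M S n g s T).
Proof.
move=> cJ; rewrite -face_jets_ext; apply: K0_class_retract.
- exact: jet_ext_poly.
- exact: jet_res_poly.
- exact: jet_extK.
- by rewrite face_jets_ext; exact: face_jets_constructible.
Qed.

End Face.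

Lemma face_jets_inj (M' : zmodType) (h : {additive M' -> M}) (S' : set M') n (g' : 'I_n -> M') :
    injective h -> (forall i, S' (g' i)) ->
  @face_jets K M' S' n g' s S' = @face_jets K M (h @` S') n (h \o g') s (h @` S').
Proof.
move=> h_inj S'g.
have nsp P u : nspan g' P u <-> nspan (h \o g') P (h u).
  split=> -[c e]; exists c; [|apply: h_inj]; rewrite e raddf_sum; apply: eq_bigr => i _;
    by rewrite raddfMn.
have hull x : face_hull S' g' (jsupp x) = S' <->
    face_hull (h @` S') (h \o g') (@jsupp K n s x) = h @` S'.
  split=> e.
    apply/seteqP; split => [u []//|_ [u S'u <-]]; split; first by exists u.
    have : face_hull S' g' (jsupp x) u by rewrite e.
    by move=> [_ [v S'v /nsp uv]]; exists (h v); [exists v|rewrite -raddfD].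
  apply/seteqP; split => [u []//|u S'u]; split => //.
  have : face_hull (h @` S') (h \o g') (jsupp x) (h u) by rewrite e; exists u.
  by move=> [_ [_ [v S'v <-] uv]]; exists v => //; apply/nsp; rewrite raddfD.
apply/seteqP; split => x [[chi chiS ->] /hull e]; split => //.
  have [chi0 chiD chi1] := chiS.
  pose inv u := if pselect (exists v, h v = u) is left ex then sval (cid ex) else 0.
  have invK v : inv (h v) = v.
    by rewrite /inv; case: pselect => [ex|[]]; [apply: h_inj; exact: svalP (cid ex)|exists v].
  exists (chi \o inv); last by congr jet_row; apply/funext => i /=; rewrite invK.
  split => [|_ _ [u S'u <-] [v S'v <-]|_ [u S'u <-] hu] /=.
  - by rewrite -(raddf0 h) invK.
  - by rewrite -raddfD !invK chiD.
  - by rewrite invK chi1 // => u0; apply: hu; rewrite u0 raddf0.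
have [chi0 chiD chi1] := chiS; exists (chi \o h) => //.
split => [|u v S'u S'v|u S'u u0] /=; first by rewrite raddf0.
  by rewrite raddfD chiD.
by apply: chi1; [exists u|rewrite -(raddf0 h) => /h_inj].
Qed.

End Transfer.

(** * Arcs as characters *)

Section ArcsCharacters.
Variables (R : realType) (M : zmodType) (L : addrClosed M).
Notation C := R[i].
Implicit Types (h : arc R L) (theta : set (NR R M)).

Lemma monoD (N : nmodType) (u v : N) :
  mono (u + v) = mono u * mono v :> monoid_alg C N.
Proof. by rewrite {1}/GRing.mul /= malg_mulUU mulr1. Qed.

Lemma arc_character h : has_origin0 h ->
  exists2 chi, character (sg_set L) chi & forall v, h (mono v) = chi (sg_val v).
Proof.
move=> h0; pose chi u : fps C := oapp (fun v : sg_elt L => h (mono v)) 0 (insub u).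
have chiE v : chi (sg_val v) = h (mono v) by rewrite /chi -[sg_val v]/(\val v) valK.
exists chi => //; split=> [|u v uL vL|u uL u0].
- by rewrite -[0](sg_val0 L) chiE -[mono 0]/(1 : monoid_alg C (sg_elt L)) rmorph1.
- rewrite -[u]/(sg_val (SgElt uL)) -[v]/(sg_val (SgElt vL)) -sg_valD.
  by rewrite !chiE monoD rmorphM.
- rewrite -[u]/(sg_val (SgElt uL)) chiE h0 //; apply/eqP => /(congr1 (@sg_val M L)).
  exact: u0.
Qed.

Lemma character_arc (chi : M -> fps C) : character (sg_set L) chi ->
  exists2 h : arc R L, has_origin0 h & forall v, h (mono v) = chi (sg_val v).
Proof.
move=> [chi0 chiD chi1].
have F0 : chi (sg_val (0 : sg_elt L)) = 1 by [].
have FD : {morph (fun v : sg_elt L => chi (sg_val v)) : u v / u + v >-> u * v}.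
  by move=> u v; apply: chiD; exact: sg_valP.
exists (alg_ext F0 FD) => [u u0|u]; last exact: alg_ext_mono.
rewrite alg_ext_mono chi1 //; first exact: sg_valP.
by move=> uE; move/eqP: u0; apply; apply: sg_val_inj.
Qed.

Lemma jetE s h : jet s h = jet_row s (fun i => h (mono (min_gens L)`_i)).
Proof. by []. Qed.

Lemma jet_arcs0 s : jet s @` arcs0 R L = jet_set (sg_set L) (@min_gen M L) s.
Proof.
apply/seteqP; split => [_ [h /arc_character[chi chiL hE] <-]|_ [chi /character_arc[h h0 hE]
  ->]].
  by exists chi => //; rewrite jetE; congr jet_row; apply/funext => i; rewrite hE.
by exists h => //; rewrite jetE; congr jet_row; apply/funext => i; rewrite hE.
Qed.

Lemma jet_arcs0_star s : jet s @` arcs0_star R L =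
  [set x | exists chi, [/\ character (sg_set L) chi, forall u, u \in L -> chi u != 0 &
     x = jet_row s (chi \o @min_gen M L)]].
Proof.
apply/seteqP; split => x.
  move=> [h [/arc_character[chi chiL hE] h1] <-]; exists chi; split => //.
    by move=> u uL; rewrite -[u]/(sg_val (SgElt uL)) -hE.
  by rewrite jetE; congr jet_row; apply/funext => i; rewrite hE.
move=> [chi [/character_arc[h h0 hE] chi1 ->]]; exists h.
  by split => // u; rewrite hE chi1 //; exact: sg_valP.
by rewrite jetE; congr jet_row; apply/funext => i; rewrite hE.
Qed.

End ArcsCharacters.

Section ArcsPerp.
Variables (R : realType) (M : zmodType) (L : addrClosed M).
Notation C := R[i].
Implicit Types (theta : set (NR R M)).

Lemma to_perp_lin_ext theta (a : monoid_alg C (sg_elt L)) :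
  to_perp theta a =
  lin_ext (fun u => oapp (fun v : sg_elt (perp L theta) => mono v) 0 (insub (sg_val u)) :
    monoid_alg C (sg_elt (perp L theta))) a.
Proof.
by apply: eq_bigr => u _; case: (insub _) => [v|] //=; rewrite scaler0.
Qed.

(** The surjection [to_perp] kills the monomials outside perp L theta, so a
    character factors through it exactly when it vanishes there. *)
Lemma jet_arcs0_perp theta s : jet s @` arcs0_perp L theta =
  [set x | exists chi, [/\ character (sg_set L) chi,
     forall u, u \in L -> u \notin perp L theta -> chi u = 0 &
     x = jet_row s (chi \o @min_gen M L)]].
Proof.
have mE (u : sg_elt L) : to_perp theta (mono u) =
    oapp (fun v : sg_elt (perp L theta) => mono v) 0 (insub (sg_val u)).
  by rewrite to_perp_lin_ext lin_ext_mono.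
apply/seteqP; split => x.
  move=> [h [k k0 hk] <-].
  have h0 : has_origin0 h.
    move=> u u0; rewrite hk mE; case: insubP => [v vp vu|_] /=; last by rewrite raddf0.
    apply: k0; apply/eqP => v0; move/eqP: u0; apply; apply: sg_val_inj.
    by rewrite -vu v0.
  have [chi chiL hE] := arc_character h0; exists chi; split => //; last first.
    by rewrite jetE; congr jet_row; apply/funext => i; rewrite hE.
  move=> u uL up; rewrite -[u]/(sg_val (SgElt uL)) -hE hk mE insubN //=.
  by rewrite raddf0.
move=> [chi [chiL chi0 ->]]; have [h h0 hE] := character_arc chiL.
have chip : character (sg_set (perp L theta)) chi.
  by apply: character_res chiL => u /perpP[].
have [k k0 kE] := character_arc chip; exists h; last first.
  by rewrite jetE; congr jet_row; apply/funext => i; rewrite hE.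
exists k => // a; move: a.
apply: (@monoid_alg_ext _ _ _ h (fun a => k (to_perp theta a))) => [a b|a b|c u].
- exact: raddfD.
- by rewrite !to_perp_lin_ext lin_extD raddfD.
rewrite mkmalgU_scale linearZ /= hE to_perp_lin_ext lin_extZ lin_ext_mono linearZ /=.
congr (_ *: _); case: insubP => [v vp vu|up] /=; first by rewrite kE -vu.
by rewrite raddf0 chi0 //; exact: sg_valP.
Qed.

End ArcsPerp.

Section StarJets.
Variables (R : realType) (M : zmodType) (L : addrClosed M).
Hypotheses (pL : pointed (sg_set L)) (fgL : fin_generated L).
Hypothesis sep : forall u : M, u <> 0 -> exists y : {additive M -> int}, y u <> 0.
Hypothesis spanL : smallest (@is_subgroup M) [set u | u \in L] = setT.

(** L spans M, so a form that vanishes on L is null. *)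
Lemma face_perp_all (theta : set (NR R M)) : is_face (cone_of R L) theta ->
  (forall u, u \in L -> u \in perp L theta) -> theta = [set nu | forall u, nu u = 0].
Proof.
move=> ft Lp; apply/seteqP; split => nu.
  move=> tnu u; have : smallest (@is_subgroup M) [set u | u \in L] u by rewrite spanL.
  move=> /(_ [set u | nu u = 0]); apply; split.
    by split => /= [|x y x0 y0]; rewrite ?raddf0 // raddfB x0 y0 subrr.
  by move=> v /Lp/perpP[_]; apply.
move=> nu0; have [k [c [u [_ ->]]]] := (is_faceP _ _).1 ft; split.
  by apply/dual_coneP => v _; rewrite nu0.
by apply: big1 => i _; rewrite nu0 mulr0.
Qed.

(** A jet lies in none of the sets of the proper faces exactly when the face
    it spans is the whole semigroup: otherwise the values of its character
    outside that face can be replaced by 0. The character of a jet that spans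
    L vanishes nowhere, since the elements where it does not vanish form a
    face. *)
Lemma star_jets s :
  jet s @` arcs0_star R L `\` \bigcup_(theta in nonzero_faces R L) jet s @` arcs0_perp L theta
  = face_jets (sg_set L) (@min_gen M L) s (sg_set L).
Proof.
have gS := min_gen_span fgL.
have S0 : sg_set L 0 by exact: rpred0.
have SD u v : sg_set L u -> sg_set L v -> sg_set L (u + v) by exact: rpredD.
have Sg i : sg_set L (@min_gen M L i) by exact: sg_valP.
apply/seteqP; split => x.
  rewrite jet_arcs0_star => -[[chi [chiL chi1 xE]] nx]; split; first by exists chi.
  have fF := face_hull_sface (@min_gen M L) (jsupp x) S0 SD.
  have [theta ft tE] := sface_perp R gS sep fF.
  have t0 : theta = [set nu | forall u, nu u = 0].
    apply: contrapT => tn0; apply: nx; exists theta => //.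
    rewrite jet_arcs0_perp.
    have [FS _ _ _] := fF.
    exists (fun u => if `[< face_hull (sg_set L) (@min_gen M L) (jsupp x) u >] then chi u
      else 0).
    split; first by apply: character_ext => //; exact: character_res FS _.
      by move=> u uL /negP up; rewrite asboolF // => /tE.
    apply: (can_inj vec_mxK); apply/matrixP => i k; rewrite vec_jet_row /=.
    case: asboolP => [_|nF]; first by rewrite xE vec_jet_row.
    by apply: jsuppPn; apply/negP => xi; apply: nF; exact: face_hull_gen.
  apply/seteqP; split => [u []//|u uL]; apply/tE; apply/perpP; split => // nu.
  by rewrite t0; apply.
move=> [[chi chiL xE] e]; split.
  rewrite jet_arcs0_star; exists chi; split => // u uL.
  have fT := character_sface S0 SD chiL.
  have : face_hull (sg_set L) (@min_gen M L) (jsupp x) u by rewrite e.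
  move/(face_hull_min fT) => /= [i|//]; rewrite unfold_in => /existsP[k].
  move=> xk; split => //; apply/eqP => c0; move/eqP: xk; apply.
  by rewrite xE vec_jet_row /= c0.
move=> [theta [ft tn0]]; rewrite jet_arcs0_perp => -[chi' [chi'L chi'0 xE']].
apply: tn0; apply: face_perp_all => // u uL.
have : face_hull (sg_set L) (@min_gen M L) (jsupp x) u by rewrite e.
apply: (face_hull_min (perp_sface ft)) => i /=; rewrite unfold_in => /existsP[k].
apply: contraR => np; rewrite xE' vec_jet_row /= chi'0 //; exact: sg_valP.
Qed.

End StarJets.

(** * Lattices and strictly convex cones *)

Section LatticeCoordinates.
Variables (M : zmodType) (d : nat) (latM : is_lattice M d).

Lemma lattice_coordinates : exists e : {additive M -> 'rV[int]_d}, injective e.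
Proof.
have [b hb] := latM; have /all_sig[c cP] := fun x => cid (hb x).
pose e (x : M) : 'rV[int]_d := \row_i c x i.
have cE x (f : {ffun 'I_d -> int}) : x = \sum_i b i *~ f i -> c x = f.
  by move=> xf; have [_] := cP x; apply.
have eB : zmod_morphism e.
  move=> x y; apply/rowP => i; rewrite !mxE.
  rewrite (cE _ [ffun i => c x i - c y i]) ?ffunE //.
  rewrite [in LHS](cP x).1 [in LHS](cP y).1 -sumrB; apply: eq_bigr => j _.
  by rewrite ffunE mulrzBr.
exists (HB.pack_for {additive M -> 'rV[int]_d} e (GRing.isZmodMorphism.Build M _ e eB)).
move=> x y /= /rowP exy; rewrite (cP x).1 (cP y).1; apply: eq_bigr => i _.
by have := exy i; rewrite !mxE => ->.
Qed.

Lemma lattice_separated (u : M) : u <> 0 -> exists y : {additive M -> int}, y u <> 0.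
Proof.
have [e e_inj] := lattice_coordinates => u0.
have [j ej] : exists j, e u ord0 j <> 0.
  apply: contrapT => h; apply: u0; apply: e_inj; rewrite raddf0; apply/rowP => j.
  by rewrite mxE; apply: contrapT => ej; apply: h; exists j.
pose y (v : M) : int := e v ord0 j.
have yB : zmod_morphism y by move=> v w; rewrite /y raddfB !mxE.
by exists (HB.pack_for {additive M -> int} y (GRing.isZmodMorphism.Build M _ y yB)).
Qed.

End LatticeCoordinates.

Lemma strictly_convex_pointed (R : realType) (M : zmodType) (L : addrClosed M) :
    (forall u : M, u <> 0 -> exists y : {additive M -> int}, y u <> 0) ->
  strictly_convex (cone_of R L) -> pointed (sg_set L).
Proof.
move=> sep convL u v uL vL uv; apply: contrapT => /sep[y]; apply.
have cone w : w \in L -> cone_of R L (inMR w).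
  by move=> wL; exists 1%N, (fun=> 1), (fun=> w); split=> [i|];
    [split|rewrite big_ord1 scale1r].
have vE : v = - u by apply/eqP; rewrite -addr_eq0 addrC uv.
have := convL (inMR u) (cone _ uL).
have -> : - (inMR u : MR R M) = inMR v.
  by apply/funext => nu; rewrite /inMR vE raddfN.
move=> /(_ (cone _ vL)) u0.
have /eqP : (intr (y u) : R) = 0.
  exact: (congr1 (fun w : MR R M => w ((intr : {additive int -> R}) \o y)) u0).
by rewrite intr_eq0 => /eqP.
Qed.

(** * The semigroup of a face *)

Section FaceSemigroup.
Variables (R : realType) (M : zmodType) (L : addrClosed M) (theta : set (NR R M)).
Hypotheses (pL : pointed (sg_set L)) (fgL : fin_generated L).
Hypothesis sep : forall u : M, u <> 0 -> exists y : {additive M -> int}, y u <> 0.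
Hypothesis ft : is_face (cone_of R L) theta.

Let T := sg_set (perp L theta).
Let M' := lat_elt (perp L theta).
Let L' : addrClosed M' := lat_sg (perp L theta).
Let h : {additive M' -> M} := (\val : {additive M' -> M}).

Let h_inj : injective h. Proof. exact: val_inj. Qed.

Lemma face_lift u : T u -> exists2 v : M', sg_set L' v & h v = u.
Proof.
move=> Tu; have uS : u \in span_pred (perp L theta).
  by apply/asboolP => H [_]; apply.
by exists (LatElt uS).
Qed.

Lemma face_image : h @` sg_set L' = T.
Proof. by apply/seteqP; split => [_ [v L'v <-]//|u /face_lift[v L'v <-]]; exists v. Qed.

Lemma face_separated (u : M') : u <> 0 -> exists y : {additive M' -> int}, y u <> 0.
Proof.
move=> u0; have [|y yu] := sep (u := h u); last by exists (y \o h).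
by rewrite -(raddf0 h) => /h_inj.
Qed.

Lemma face_pointed : pointed (sg_set L').
Proof.
move=> u v L'u L'v uv; apply: h_inj; rewrite raddf0.
have sub w : sg_set L' w -> sg_set L (h w).
  move=> L'w; have : T (h w) by rewrite -face_image; exists w.
  by move=> /perpP[].
by apply: (pL (sub _ L'u) (sub _ L'v)); rewrite -raddfD uv raddf0.
Qed.

Lemma face_span : smallest (@is_subgroup M') [set u | u \in L'] = setT.
Proof.
apply/seteqP; split => // x _ H [[H0 HB] L'H].
have /asboolP := lat_valP x.
move=> /(_ [set u | exists2 z, H z & h z = u]) [|z Hz /h_inj <- //].
split; last by move=> u /face_lift[v L'v <-]; exists v => //; apply: L'H.
split; first by exists 0; rewrite ?raddf0.
by move=> _ _ [u Hu <-] [v Hv <-]; exists (u - v); [exact: HB|rewrite raddfB].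
Qed.

(** The generators of L in perp L theta generate it, since perp L theta is a
    face of L. *)
Lemma face_fin_generated : fin_generated L'.
Proof.
have gS := min_gen_span fgL; have fT := perp_sface ft.
have /all_sig2[k kL' kE] : forall i,
    {v : M' | sg_set L' v & T (@min_gen M L i) -> h v = min_gen i}.
  move=> i; apply: cid2; have [/face_lift[v L'v vE]|nT] := pselect (T (@min_gen M L i)).
    by exists v.
  by exists 0 => //; exact: rpred0.
exists [seq SgElt (kL' i) | i <- enum 'I_(size (min_gens L))].
apply/generatesP => Q Q0 QD Qk u.
have : T (h (sg_val u)) by rewrite -face_image; exists (sg_val u) => //; exact: sg_valP.
rewrite [T](sface_span fT gS) => -[c uc].
pose w : sg_elt L' := \sum_(i | `[< T (min_gen i) >]) SgElt (kL' i) *+ c i.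
suff -> : u = w.
  apply: (big_ind Q) => // i _; have Qi : Q (SgElt (kL' i)) by apply: Qk;
    rewrite map_f // mem_enum.
  by elim: (c i) => [|m IH]; rewrite ?mulr0n // mulrS; apply: QD.
apply: sg_val_inj; apply: h_inj; rewrite uc /w.
rewrite (@big_morph _ _ (@sg_val M' L') 0 +%R 0 +%R) // raddf_sum; apply: eq_bigr => i Ti.
have -> : sg_val (SgElt (kL' i) *+ c i) = k i *+ c i.
  by elim: (c i) => [|m IH]; rewrite ?mulr0n // !mulrS sg_valD IH.
by rewrite raddfMn kE //; apply/asboolP.
Qed.

Lemma irreducible_image v : irreducible (sg_set L') v <-> irreducible T (h v).
Proof.
rewrite -face_image; split=> [[L'v v0 hv]|[[w L'w /h_inj wv] v0 hv]].
  split => [||_ _ [a L'a <-] [b L'b <-]]; first by exists v.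
    by rewrite -(raddf0 h) => /h_inj.
  by rewrite -raddfD => /h_inj /(hv _ _ L'a L'b) [->|->]; rewrite raddf0; [left|right].
split => [||a b L'a L'b vab]; first by rewrite -wv.
  by move=> v00; apply: v0; rewrite v00 raddf0.
have [|||a0|b0] := hv (h a) (h b); first by exists a.
- by exists b.
- by rewrite vab raddfD.
- by left; apply: h_inj; rewrite a0 raddf0.
- by right; apply: h_inj; rewrite b0 raddf0.
Qed.

(** Two identifications: of the semigroup of theta inside the lattice that it
    spans with perp L theta inside M, and of the minimal generators of the
    latter with the minimal generators of L that it contains. *)
Lemma P_perpE s :
    constructible (jet_set (sg_set L) (@min_gen M L) s : set 'rV[R[i]]_(_ * s.+1)) ->
  P_perp L theta s = K0_class (@face_jets R[i] M (sg_set L) _ (@min_gen M L) s T).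
Proof.
move=> cJ; rewrite /P_perp /P_sg.
rewrite (star_jets R face_fin_generated face_separated face_span).
have fg' := face_fin_generated; have fT := perp_sface ft.
rewrite (face_jets_inj _ _ h_inj) => [|i]; last exact: sg_valP.
rewrite face_image.
(* f sends the minimal generators of the face to those of L *)
have /all_sig[f fE] : forall i', {i | @min_gen M L i = h (@min_gen M' L' i')}.
  move=> i'; apply: cid; apply/(min_genP pL fgL).
  suff : irreducible T (h (min_gen i')) by move/(irreducible_sface _ fT) => [].
  by apply/irreducible_image/(min_genP face_pointed fg'); exists i'.
apply: (K0_class_face_jets_ext (min_gen_span fgL) _ fT (f := f)) => //.
- transitivity (h @` sg_set L'); last exact: face_image.
  rewrite -(min_gen_span fg'); apply/seteqP; split => u.
    move=> [c ->]; exists (\sum_(i in predT) min_gen i *+ c i); first by exists c.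
    by rewrite raddf_sum; apply: eq_bigr => i _; rewrite raddfMn.
  by move=> [_ [c ->] <-]; exists c; rewrite raddf_sum; apply: eq_bigr => i _; rewrite raddfMn.
- by move=> i j fij; apply: (min_gen_inj fg'); apply: h_inj; rewrite -!fE fij.
move=> i Ti; have irr : irreducible (sg_set L) (min_gen i) by apply/(min_genP pL fgL); exists i.
have : irreducible T (min_gen i) by apply/(irreducible_sface _ fT).
have [v _ vE] := face_lift Ti; rewrite -vE.
move=> /irreducible_image/(min_genP face_pointed fg')[i' i'v].
by exists i'; apply: (min_gen_inj fgL); rewrite fE i'v.
Qed.

End FaceSemigroup.

(** * The decomposition of the set of jets *)

Theorem proposition4p1 (R : realType) (d : nat) (M : zmodType) (L : addrClosed M)
    (latM : is_lattice M d)
    (fgL : fin_generated L)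
    (genM : smallest (@is_subgroup M) [set u | u \in L] = setT)
    (convL : strictly_convex (cone_of R L))
    (dimL : cone_dim (cone_of R L) d) :
  P_geom R L =
  \sum_(theta \in [set theta | is_face (cone_of R L) theta]) P_perp L theta.
Proof.
have sep := lattice_separated latM.
have pL := strictly_convex_pointed sep convL.
have gS := min_gen_span fgL.
have [e e_inj] := lattice_coordinates latM.
have g0 i : @min_gen M L i <> 0.
  by have [] := (min_genP pL fgL (min_gen i)).1 (ex_intro _ i erefl).
have finF := finite_faces R gS.
rewrite (fsbig_finite _ _ finF); apply/funext => s.
rewrite (@big_morph _ _ (fun f : fps (K0 R[i]) => f s) 0 +%R 0 +%R) //.
have cJ : constructible (@jet_set R[i] M (sg_set L) _ (@min_gen M L) s).
  by rewrite -gS; exact: (jet_set_constructible R[i] s e_inj g0).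
have mF theta : theta \in fset_set [set theta | is_face (cone_of R L) theta] ->
    is_face (cone_of R L) theta by rewrite in_fset_set // inE.
rewrite /P_geom jet_arcs0.
pose E (theta : set (NR R M)) :=
  @face_jets R[i] M (sg_set L) _ (@min_gen M L) s (sg_set (perp L theta)).
have cE theta : constructible (E theta) by exact: face_jets_constructible.
rewrite [RHS](eq_big_seq (fun theta => K0_class (E theta))) => [|theta /mF ft];
  last exact: P_perpE.
rewrite -K0_class_bigU //.
- congr K0_class; apply/seteqP; split => [x Jx|x [theta _ []]//].
  have S0 : sg_set L 0 by exact: rpred0.
  have SD u v : sg_set L u -> sg_set L v -> sg_set L (u + v) by exact: rpredD.
  have [theta ft tE] := sface_perp R gS sep (face_hull_sface (@min_gen M L) (jsupp x) S0 SD).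
  exists theta; first by rewrite in_fset_set // inE.
  by split => //; apply/seteqP; split => u; rewrite /sg_set /=; apply tE.
- move=> theta theta' x /mF ft /mF ft' [_ e1] [_]; rewrite e1 => e2.
  apply: (face_perp_inj ft ft') => u.
  have hu : sg_set (perp L theta) u <-> sg_set (perp L theta') u by rewrite e2.
  by apply/idP/idP => up; apply/hu.
Qed.
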